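(* Let $(\mu_n)_{n\in\mathbb{N}}$ be a sequence of sofic random rooted simplicial complexes with uniformly bounded vertex degree, i.e. there is $D<\infty$ with $\deg(\mu_n)\le D$ for all $n\in\mathbb{N}$. If $(\mu_n)_{n\in\mathbb{N}}$ converges weakly to a random rooted simplicial complex $\mu$, then the $\ell^2$-Betti numbers of $\mu_n$ converge to the $\ell^2$-Betti numbers of $\mu$, i.e. for every integer $p\ge 0$ \[\lim_{n\to\infty}\beta^{(2)}_p(\mu_n)=\beta^{(2)}_p(\mu).\]
   Context: **Rooted complexes.** A rooted simplicial complex $(K,x)$ is a simplicial complex $K$ with vertex set $V(K)$ and a chosen vertex $x\in V(K)$. $K$ is locally finite if every vertex lies in only finitely many simplices. $(K,x)$ and $(L,y)$ are isomorphic if there is a simplicial isomorphism $K\to L$ mapping $x$ to $y$. $\mathcal{SC}_*$ denotes the set of isomorphism classes $[K,x]$ of connected locally finite rooted simplicial complexes. $B_{(K,x)}(r)$ is the rooted subcomplex of all simplices of $K$ all of whose vertices have graph distance at most $r$ to $x$. $\mathcal{SC}_*$ carries the metric $d([K,x],[L,y])=\inf\{2^{-r} : B_{(K,x)}(r)\cong B_{(L,y)}(r)\}$ (isomorphism of rooted complexes), which makes it a Polish space. $K(p)$ is the set of $p$-simplices of $K$. **Random rooted simplicial complexes.** A random rooted simplicial complex is a Borel probability measure $\mu$ on $\mathcal{SC}_*$. The degree $\deg(x)$ of a vertex is the number of $1$-simplices containing it, $\deg_{max}([K,x])=\sup_{v\in V(K)}\deg(v)$, and $\deg(\mu)$ is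 the $\mu$-essential supremum of $\deg_{max}$; $\mu$ has bounded degree if $\deg(\mu)<\infty$. Weak convergence $\mu_n\to\mu$ means $\int f\,d\mu_n\to\int f\,d\mu$ for all bounded continuous $f:\mathcal{SC}_*\to\mathbb{R}$. **Sofic.** For a finite simplicial complex $K$ put $\mu_K=\frac{1}{|V(K)|}\sum_{x\in V(K)}\delta_{[K_x,x]}$, where $K_x$ is the connected component of $x$. $\mu$ is sofic if there is a sequence $(K_n)_n$ of finite connected simplicial complexes such that $\mu_{K_n}$ converges weakly to $\mu$. **$\ell^2$-Betti numbers.** For a simplicial complex $K$ of bounded vertex degree let $C_p^{(2)}(K)$ be the Hilbert space of square-summable (real or complex) simplicial $p$-chains; choosing one orientation for each $p$-simplex, the oriented $p$-simplices form an orthonormal basis. Let $\partial_p:C_p^{(2)}(K)\to C_{p-1}^{(2)}(K)$ be the simplicial boundary operator ($\partial_0=0$), a bounded operator, and $\Delta_p=\partial_p^*\partial_p+\partial_{p+1}\partial_{p+1}^*$. Let $P_p^K$ be the orthogonal projection of $C_p^{(2)}(K)$ onto $\ker\Delta_p$. For a random rooted simplicial complex $\mu$ of bounded degree, \[\beta_p^{(2)}(\mu)=\int_{\mathcal{SC}_*}\ \sum_{\sigma\in K(p),\,x\in\sigma}\frac{\langle P_p^K\sigma,\sigma\rangle}{p+1}\,d\mu([K,x]).\] (The integrand does not depend on the orientations or on the representative $(K,x)$. A weak limit of measures of degree at most $D$ again has degree at most $D$.) *)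

(* Defs.v *)
From HB Require Import structures.
From mathcomp Require Import all_boot all_order all_algebra.
From mathcomp Require Import finmap generic_quotient.
From mathcomp Require Import all_classical all_reals all_analysis.
From mathcomp Require Import ess_sup_inf.

Set Implicit Arguments.
Unset Strict Implicit.
Unset Printing Implicit Defensive.
Import Order.TTheory GRing.Theory Num.Theory.
Import numFieldNormedType.Exports.

Local Open Scope classical_set_scope.
Local Open Scope quotient_scope.
Local Open Scope ring_scope.

(* A connected locally finite complex has countably many vertices, so vertices
   in [nat] suffice to represent every isomorphism class of such complexes, as
   well as every finite complex. *)
Record complex := Complex {
  simplices :> {fset nat} -> Prop ;
  simplex_neq0 : forall s, simplices s -> s != fset0 ;
  simplex_face : forall s t, simplices s -> (t `<=` s)%fset -> t != fset0 ->
    simplices t }.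

Definition verts (K : complex) : set nat := [set v | K [fset v]%fset].

Definition simp (K : complex) (p : nat) : set {fset nat} :=
  [set s | K s /\ #|` s| = p.+1].

Definition adj (K : complex) (u v : nat) : Prop := u != v /\ K [fset u; v]%fset.

Definition dist_le (K : complex) (r : nat) (u v : nat) : Prop :=
  exists w : seq nat,
    [/\ path (fun a b => `[< adj K a b >]) u w, last u w = v & (size w <= r)%N].

Definition connected_cplx (K : complex) : Prop :=
  verts K !=set0 /\
  forall u v, verts K u -> verts K v -> exists r, dist_le K r u v.

Definition locally_finite (K : complex) : Prop :=
  forall v, verts K v -> finite_set [set s | K s /\ v \in s].

Definition is_isom (f : nat -> nat) (K : complex) (x : nat) (L : complex)
    (y : nat) : Prop :=
  [/\ set_bij (verts K) (verts L) f, f x = y &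
      forall s : {fset nat}, (forall v, v \in s -> verts K v) ->
        K s <-> L (f @` s)%fset].

Definition isom K x L y : Prop := exists f, is_isom f K x L y.

Section full_subcomplex.
Variables (K : complex) (P : nat -> Prop).

Let S : set {fset nat} := [set s | K s /\ forall v, v \in s -> P v].

Let S_neq0 s : S s -> s != fset0.
Proof. by case=> /simplex_neq0. Qed.

Let S_face s t : S s -> (t `<=` s)%fset -> t != fset0 -> S t.
Proof.
move=> [Ks sP] ts t0; split; first exact: simplex_face Ks ts t0.
by move=> v /(fsubsetP ts); exact: sP.
Qed.

Definition full_sub : complex := Complex S_neq0 S_face.

Lemma verts_full_sub v : verts full_sub v <-> verts K v /\ P v.
Proof.
split=> [[Kv vP]|[Kv Pv]]; first by split=> //; apply: vP; rewrite inE.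
by split=> // w; rewrite inE => /eqP ->.
Qed.

End full_subcomplex.

Definition cball (K : complex) (x : nat) (r : nat) : complex :=
  full_sub K (fun v => dist_le K r x v).

Definition component (K : complex) (x : nat) : complex :=
  full_sub K (fun v => exists r, dist_le K r x v).

Section distance.
Implicit Types (K L : complex) (x y u v : nat).

Lemma adj_vertsr K u v : adj K u v -> verts K v.
Proof.
move=> [_ /simplex_face]; apply; last by apply/fset0Pn; exists v; rewrite inE.
by apply/fsubsetP => w; rewrite !inE => /eqP ->; rewrite eqxx orbT.
Qed.

Lemma adj_vertsl K u v : adj K u v -> verts K u.
Proof.
move=> [_ /simplex_face]; apply; last by apply/fset0Pn; exists u; rewrite inE.
by apply/fsubsetP => w; rewrite !inE => /eqP ->; rewrite eqxx.
Qed.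

Lemma adj_sym K u v : adj K u v -> adj K v u.
Proof. by move=> [uv Kuv]; split; [rewrite eq_sym|rewrite fsetUC]. Qed.

Lemma dist_le0 K r x : dist_le K r x x.
Proof. by exists [::]. Qed.

Lemma dist_le0P K x v : dist_le K 0 x v -> v = x.
Proof. by case=> -[|a w] []. Qed.

Lemma dist_leS K r x u v : dist_le K r x u -> adj K u v -> dist_le K r.+1 x v.
Proof.
move=> [w [pw <- sw]] a; exists (rcons w v).
by rewrite rcons_path last_rcons size_rcons ltnS; split=> //; rewrite pw; apply/asboolP.
Qed.

Lemma dist_leSP K r x v : dist_le K r.+1 x v ->
  v = x \/ exists2 u, dist_le K r x u & adj K u v.
Proof.
move=> [w [pw wv sw]]; case/lastP: w pw wv sw => [|w z]; first by left.
rewrite rcons_path last_rcons size_rcons ltnS => /andP[pw /asboolP a] zv sw.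
by right; exists (last x w); [exists w|rewrite -zv].
Qed.

Lemma dist_le_leq K r s x v : (r <= s)%N -> dist_le K r x v -> dist_le K s x v.
Proof. by move=> rs [w [? ? sw]]; exists w; split => //; exact: leq_trans rs. Qed.

Lemma dist_le_ind K x (P : nat -> nat -> Prop) :
  (forall r, P r x) ->
  (forall r u v, dist_le K r x u -> P r u -> adj K u v -> P r.+1 v) ->
  forall r v, dist_le K r x v -> P r v.
Proof.
move=> P0 PS; elim=> [|r IH] v.
  by move/dist_le0P => ->; exact: P0.
move=> /dist_leSP[->|[u du a]]; first exact: P0.
exact: PS (IH _ du) a.
Qed.

Lemma dist_le_trans K r s x u v :
  dist_le K r x u -> dist_le K s u v -> dist_le K (r + s) x v.
Proof.
move=> xu; move: s v; apply: dist_le_ind => [s|s a b _ IH ab].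
  by apply: dist_le_leq xu; exact: leq_addr.
by rewrite addnS; exact: dist_leS IH ab.
Qed.

Lemma dist_le_sym K r x v : dist_le K r x v -> dist_le K r v x.
Proof.
move: r v; apply: dist_le_ind => [r|r u v _ IH ab]; first exact: dist_le0.
rewrite -add1n; apply: dist_le_trans IH.
by apply: dist_leS (adj_sym ab); exact: dist_le0.
Qed.

Lemma dist_le_verts K r x v : verts K x -> dist_le K r x v -> verts K v.
Proof.
by move=> Kx; move: r v; apply: dist_le_ind => // r u v _ _; exact: adj_vertsr.
Qed.

Lemma finite_dist_le K r x : verts K x -> locally_finite K ->
  finite_set [set v | dist_le K r x v].
Proof.
move=> Kx lfK; elim: r => [|r IH].
  apply: (@sub_finite_set _ _ [set x]); last exact: finite_set1.
  by move=> v /dist_le0P.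
pose A := \bigcup_(u in [set v | dist_le K r x v])
  \bigcup_(s in [set s | K s /\ u \in s]) [set v | v \in s].
apply: (@sub_finite_set _ _ (x |` A)).
  move=> v /dist_leSP[->|[u du a]]; [by left|right].
  exists u => //; exists [fset u; v]%fset; last by rewrite /= !inE eqxx orbT.
  by split; [case: a|rewrite !inE eqxx].
rewrite finite_setU; split; first exact: finite_set1.
apply: bigcup_finite => // u du; apply: bigcup_finite => [|s _].
  by apply: lfK; exact: dist_le_verts du.
exact: finite_fset.
Qed.

End distance.

Section isomorphisms.
Implicit Types (K L M : complex) (x y z u v : nat) (f g : nat -> nat).

Lemma is_isom_id K x : is_isom id K x K x.
Proof.
split=> [|//|s _]; first by split=> // v Kv; exists v.
by rewrite imfset_id.
Qed.

Lemma is_isom_comp f g K x L y M z :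
  is_isom f K x L y -> is_isom g L y M z -> is_isom (g \o f) K x M z.
Proof.
move=> [fb fx fs] [gb gy gs]; split.
- exact: set_bij_comp gb.
- by rewrite /= fx.
- move=> s sK; rewrite fs// gs.
    suff -> : (g @` (f @` s))%fset = ((g \o f) @` s)%fset by [].
    apply/fsetP => v; apply/imfsetP/imfsetP => /= -[u us ->].
      by case/imfsetP: us => w /= ws ->; exists w.
    by exists (f u) => //; apply/imfsetP; exists u.
  move=> _ /imfsetP[u /= us ->].
  by case: fb => + _ _; apply; exact: sK.
Qed.

Lemma is_isom_inv f K x L y : verts K x -> is_isom f K x L y ->
  exists2 g, is_isom g L y K x &
    {in verts L, forall w, f (g w) = w} /\ {in verts K, forall v, g (f v) = v}.
Proof.
move=> Kx [[ff fi fsj] fx fs].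
have /choice[g gP] : forall w, exists v, verts L w -> verts K v /\ f v = w.
  move=> w; have [Lw|nLw] := pselect (verts L w); last by exists 0%N.
  by have [v Kv vw] := fsj _ Lw; exists v.
have gf v : verts K v -> g (f v) = v.
  move=> Kv; have [Kg fg] := gP _ (ff _ Kv).
  by apply: fi; rewrite ?inE.
exists g; last first.
  by split=> [w|v]; rewrite inE; [move=> /gP[]|exact: gf].
split.
- split.
  + by move=> w /gP[].
  + by move=> u v; rewrite !inE => /gP[_ {2}<-] /gP[_ {2}<-] ->.
  + by move=> v Kv; exists (f v); [exact: ff|exact: gf].
- by rewrite -fx; exact: gf.
- move=> s sL; rewrite fs.
    suff -> : (f @` (g @` s))%fset = s by [].
    apply/fsetP => w; apply/imfsetP/idP => /= [[v vs ->]|ws].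
      by case/imfsetP: vs => u /= us ->; have [_ ->] := gP _ (sL _ us).
    by exists (g w); [apply/imfsetP; exists w|have [_ ->] := gP _ (sL _ ws)].
  by move=> _ /imfsetP[w /= ws ->]; have [] := gP _ (sL _ ws).
Qed.

Lemma isom_refl K x : isom K x K x.
Proof. by exists id; exact: is_isom_id. Qed.

Lemma isom_sym K x L y : verts K x -> isom K x L y -> isom L y K x.
Proof. by move=> Kx [f /(is_isom_inv Kx)[g ? _]]; exists g. Qed.

Lemma isom_trans K x L y M z : isom K x L y -> isom L y M z -> isom K x M z.
Proof. by move=> [f hf] [g hg]; exists (g \o f); exact: is_isom_comp hg. Qed.

Lemma verts_cball K x r v : verts K x ->
  verts (cball K x r) v <-> dist_le K r x v.
Proof.
move=> Kx; rewrite verts_full_sub; split=> [[]//|dv].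
by split=> //; exact: dist_le_verts dv.
Qed.

Lemma isom_dist_le f K x L y r s v : verts K x -> verts L y ->
  is_isom f (cball K x r) x (cball L y r) y ->
  (s <= r)%N -> dist_le K s x v -> dist_le L s y (f v).
Proof.
move=> Kx Ly [[ff fi _] fx fs] + dv.
move: s v dv; apply: dist_le_ind => [s|s u v du IH a] sr.
  by rewrite fx; exact: dist_le0.
have Bu : verts (cball K x r) u.
  by apply/verts_cball => //; exact: dist_le_leq (ltnW sr) du.
have Bv : verts (cball K x r) v.
  by apply/verts_cball => //; apply: dist_le_leq sr _; exact: dist_leS du a.
apply: dist_leS (IH (ltnW sr)) _; split.
  have [uv _] := a; apply: contra_neq uv; apply: fi; exact/mem_set.
have Buv w : w \in [fset u; v]%fset -> verts (cball K x r) w.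
  by rewrite !inE => /orP[] /eqP ->.
have [/(_ _)[]] := fs _ Buv.
  by split; [case: a|move=> w /Buv /verts_cball; exact].
by rewrite imfset_fset2.
Qed.

Lemma isom_cball_le K x L y r s : verts K x -> verts L y -> (s <= r)%N ->
  isom (cball K x r) x (cball L y r) y -> isom (cball K x s) x (cball L y s) y.
Proof.
move=> Kx Ly sr [f fI]; exists f.
have BKx : verts (cball K x r) x by apply/verts_cball => //; exact: dist_le0.
have [g gI [fg gf]] := is_isom_inv BKx fI.
have fd v : dist_le K s x v -> dist_le L s y (f v) by exact: isom_dist_le fI _.
have gd v : dist_le L s y v -> dist_le K s x (g v) by exact: isom_dist_le gI _.
case: (fI) => -[_ fi _] fx fs; split=> //.
- split.
  + by move=> v /verts_cball -/(_ Kx) dv; apply/verts_cball => //; exact: fd.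
  + move=> u v; rewrite !inE => /verts_cball -/(_ Kx) du /verts_cball -/(_ Kx) dv.
    by apply: fi; apply/mem_set/verts_cball => //; exact: dist_le_leq sr _.
  + move=> w /verts_cball -/(_ Ly) dw; exists (g w).
      by apply/verts_cball => //; exact: gd.
    by rewrite fg// inE; apply/verts_cball => //; exact: dist_le_leq sr _.
- move=> t tB.
  have td v : v \in t -> dist_le K s x v by move=> /tB/verts_cball; exact.
  have tr v : v \in t -> verts (cball K x r) v.
    by move=> /td dv; apply/verts_cball => //; exact: dist_le_leq sr _.
  have [h1 h2] := fs _ tr; split=> -[Kt tK].
    split; first by apply: (h1 _).1; split=> // v /tr /verts_cball; exact.
    by move=> _ /imfsetP[v /= vt ->]; exact/fd/td.
  split=> //; apply: (h2 _).1; split=> // w wt.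
  exact/(dist_le_leq sr)/tK.
Qed.

Lemma isom_cball0 K x L y : verts K x -> verts L y ->
  isom (cball K x 0) x (cball L y 0) y.
Proof.
move=> Kx Ly; exists (fun=> y).
have d0K v : verts (cball K x 0) v -> v = x by move=> /verts_cball -/(_ Kx)/dist_le0P.
have d0L v : verts (cball L y 0) v -> v = y by move=> /verts_cball -/(_ Ly)/dist_le0P.
have BKx : verts (cball K x 0) x by apply/verts_cball => //; exact: dist_le0.
have BLy : verts (cball L y 0) y by apply/verts_cball => //; exact: dist_le0.
split=> //.
- split=> //.
  + by move=> u v; rewrite !inE => /d0K -> /d0K ->.
  + by move=> w /d0L ->; exists x.
- move=> s sK.
  have [->|/fset0Pn[u us]] := eqVneq s fset0.
    by rewrite imfset0; split=> -[/simplex_neq0]; rewrite eqxx.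
  have -> : s = [fset x]%fset.
    apply/fsetP => v; rewrite inE; apply/idP/eqP => [/sK/d0K//|->].
    by rewrite -(d0K _ (sK _ us)).
  by rewrite imfset_fset1; split=> _.
Qed.

Lemma ultra_finite_fiber (U : set_system nat) (h : nat -> nat) (A : set nat) :
  UltraFilter U -> finite_set A -> U [set r | A (h r)] ->
  exists w, U [set r | h r = w].
Proof.
move=> UU /finite_fsetP[B ->] UA; apply: contrapT => /forallNP nU.
have UB : U (\bigcap_(w in [set` B]) [set r | h r <> w]).
  apply: filter_bigI => w _.
  by have [/nU//|] := in_ultra_setVsetC [set r | h r = w] UU.
have UI (P Q : set nat) : U P -> U Q -> U (P `&` Q) by exact: filterI.
have /filter_ex[r [rA rB]] := UI _ _ UA UB.
exact: (rB (h r)).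
Qed.

(* Koenig's lemma, through an ultrafilter limit of the isomorphisms of balls. *)
Lemma isom_all_cball K x L y :
  verts K x -> connected_cplx K -> locally_finite K ->
  verts L y -> connected_cplx L -> locally_finite L ->
  (forall r, isom (cball K x r) x (cball L y r) y) -> isom K x L y.
Proof.
move=> Kx [_ cK] lfK Ly [_ cL] lfL BI.
have Bx r : verts (cball K x r) x by apply/verts_cball => //; exact: dist_le0.
have /choice[F FI] := BI.
have /choice[G GP] : forall r, exists g, is_isom g (cball L y r) y (cball K x r) x /\
    {in verts (cball L y r), forall w, F r (g w) = w}.
  by move=> r; have [g ? []] := is_isom_inv (Bx r) (FI r); exists g.
have [U [UU U_oo]] := @ultraFilterLemma nat \oo _.
have UI (P Q : set nat) : U P -> U Q -> U (P `&` Q) by exact: filterI.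
have far M z v : (exists r, dist_le M r z v) -> U [set r | dist_le M r z v].
  move=> [d dv]; apply: U_oo; exists d => // r /= dr; exact: dist_le_leq dv.
have lim (M N : complex) z t (H : nat -> nat -> nat) : verts M z -> verts N t ->
    connected_cplx M -> locally_finite N ->
    (forall r, is_isom (H r) (cball M z r) z (cball N t r) t) ->
    forall v, exists w, verts M v -> U [set r | H r v = w].
  move=> Mz Nt [_ cM] lfN HI v.
  have [Mv|nMv] := pselect (verts M v); last by exists 0%N.
  have [d dv] := cM _ _ Mz Mv.
  have [|w wP] := @ultra_finite_fiber U (H^~ v) _ UU (finite_dist_le d Nt lfN).
    by apply: U_oo; exists d => // r /= dr; exact: isom_dist_le (HI r) _ _.
  by exists w.
have /choice[phi phiP] := lim K L x y F Kx Ly (conj (ex_intro _ x Kx) cK) lfL FI.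
have /choice[psi psiP] := lim L K y x G Ly Kx (conj (ex_intro _ y Ly) cL) lfK
  (fun r => (GP r).1).
have good (s : {fset nat}) : (forall v, v \in s -> verts K v) ->
    U [set r | forall v, v \in s -> F r v = phi v /\ dist_le K r x v].
  move=> sK; apply: (@filterS _ _ _ (\bigcap_(v in [set` s])
      [set r | F r v = phi v /\ dist_le K r x v])).
    by move=> r rs v vs; exact: rs.
  apply: filter_bigI => v /= /sK Kv.
  by apply: filterI; [exact: phiP|apply: far; exact: cK].
have phiE v : verts K v -> exists2 r, F r v = phi v & dist_le K r x v.
  move=> Kv; have /filter_ex[r /(_ v)[]] : U [set r |
      forall u, u \in [fset v]%fset -> F r u = phi u /\ dist_le K r x u].
    by apply: good => u; rewrite inE => /eqP ->.
  - by rewrite inE.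
  - by exists r.
exists phi; split.
- split.
  + move=> v Kv; have [r <- dv] := phiE _ Kv.
    apply: (@dist_le_verts _ r y) => //.
    exact: isom_dist_le (FI r) (leqnn r) dv.
  + move=> u v /set_mem Ku /set_mem Kv uv.
    have /filter_ex[r rP] : U [set r |
        forall w, w \in [fset u; v]%fset -> F r w = phi w /\ dist_le K r x w].
      by apply: good => w; rewrite !inE => /orP[] /eqP ->.
    have [|Fu du] := rP u; first by rewrite !inE eqxx.
    have [|Fv dv] := rP v; first by rewrite !inE eqxx orbT.
    have [[_ fi _] _ _] := FI r.
    apply: fi; [exact/mem_set/verts_cball|exact/mem_set/verts_cball|].
    by rewrite Fu Fv.
  + move=> w Lw.
    have /filter_ex[r [rG dw]] := UI _ _ (psiP _ Lw) (far _ _ _ (cL _ _ Ly Lw)).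
    have dp : dist_le K r x (psi w).
      by rewrite -rG; exact: isom_dist_le (GP r).1 (leqnn r) dw.
    have Kp := dist_le_verts Kx dp.
    exists (psi w) => //.
    have /filter_ex[q [[qG qd] qF]] := UI _ _
      (UI _ _ (psiP _ Lw) (far _ _ _ (cL _ _ Ly Lw))) (phiP _ Kp).
    rewrite -qF -qG; apply: (GP q).2; exact/mem_set/verts_cball.
- have [r <- _] := phiE _ Kx.
  by case: (FI r).
- move=> s sK; have /filter_ex[r rP] := good _ sK.
  have -> : (phi @` s)%fset = (F r @` s)%fset.
    apply/fsetP => w; apply/imfsetP/imfsetP => /= -[v vs ->]; exists v => //.
      by have [->] := rP v vs.
    by have [->] := rP v vs.
  have [_ _ fs] := FI r.
  have sB v : v \in s -> verts (cball K x r) v.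
    by move=> vs; apply/verts_cball => //; have [] := rP v vs.
  have [h1 h2] := fs _ sB; split=> [Ks|Ls].
    by apply: (h1 _).1; split=> // v vs; have [] := rP v vs.
  apply: (h2 _).1; split=> // _ /imfsetP[v /= vs ->].
  by apply: isom_dist_le (FI r) (leqnn r) _ => //; have [] := rP v vs.
Qed.

End isomorphisms.

Record rcomplex := RComplex {
  rc_complex :> complex ;
  rc_root : nat ;
  root_verts : verts rc_complex rc_root ;
  rc_connected : connected_cplx rc_complex ;
  rc_locally_finite : locally_finite rc_complex }.

HB.instance Definition _ := gen_eqMixin rcomplex.
HB.instance Definition _ := gen_choiceMixin rcomplex.

Definition rc_ball (K : rcomplex) (r : nat) : complex := cball K (rc_root K) r.

Definition isomb (K L : rcomplex) : bool := `[< isom K (rc_root K) L (rc_root L) >].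

Lemma isomb_refl : reflexive isomb.
Proof. by move=> K; apply/asboolP; exact: isom_refl. Qed.

Lemma isomb_sym : symmetric isomb.
Proof.
move=> K L; apply/asboolP/asboolP; apply: isom_sym; exact: root_verts.
Qed.

Lemma isomb_trans : transitive isomb.
Proof.
by move=> L K M /asboolP KL /asboolP LM; apply/asboolP; exact: isom_trans LM.
Qed.

Canonical isom_equiv := EquivRel isomb isomb_refl isomb_sym isomb_trans.

(* The parameter [R] is only the codomain of the metric. *)
Definition SC (R : realType) : Type := {eq_quot isom_equiv}.

HB.instance Definition _ (R : realType) := Choice.on (SC R).

Definition iclass {R : realType} (K : rcomplex) : SC R := \pi_({eq_quot isom_equiv}) K.

Definition irepr {R : realType} (c : SC R) : rcomplex := repr (c : {eq_quot isom_equiv}).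

Lemma iclassE (R : realType) (K L : rcomplex) :
  (iclass K = iclass L :> SC R) <-> isom K (rc_root K) L (rc_root L).
Proof. by split=> [/eqmodP/asboolP//|KL]; apply/eqmodP/asboolP. Qed.

Lemma ireprK (R : realType) (c : SC R) : iclass (irepr c) = c.
Proof. exact: reprK. Qed.

Section point.

Let S : set {fset nat} := [set [fset 0%N]%fset].

Let S_neq0 s : S s -> s != fset0.
Proof. by move=> ->; apply/fset0Pn; exists 0%N; rewrite inE. Qed.

Let S_face s t : S s -> (t `<=` s)%fset -> t != fset0 -> S t.
Proof. by move=> ->; rewrite fsubset1 => /orP[/eqP|->]. Qed.

Definition point_complex : complex := Complex S_neq0 S_face.

Let point_verts v : verts point_complex v <-> v = 0%N.
Proof. by split=> [/fset1_inj|->]. Qed.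

Let point_connected : connected_cplx point_complex.
Proof.
split; first by exists 0%N.
move=> u v /point_verts -> /point_verts ->; exists 0%N; exact: dist_le0.
Qed.

Let point_locally_finite : locally_finite point_complex.
Proof.
by move=> v _; apply: (@sub_finite_set _ _ S); [move=> s []|exact: finite_set1].
Qed.

Definition point_rcomplex : rcomplex :=
  @RComplex point_complex 0%N erefl point_connected point_locally_finite.

End point.

HB.instance Definition _ (R : realType) := isPointed.Build (SC R) (iclass point_rcomplex).

Section metric.
Variable R : realType.
Implicit Types c : SC R.

Definition balls_isom c1 c2 (r : nat) : Prop :=
  isom (rc_ball (irepr c1) r) (rc_root (irepr c1)) (rc_ball (irepr c2) r) (rc_root (irepr c2)).

(* Balls of real radius [r] coincide with those of radius [Num.floor r], so the
   infimum is taken over natural radii. *)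
Definition SCdist c1 c2 : R := inf [set 2^-1 ^+ r | r in balls_isom c1 c2].

Let A c1 c2 : set R := [set 2^-1 ^+ r | r in balls_isom c1 c2].

Let A_inf c1 c2 : has_inf (A c1 c2).
Proof.
split; first by exists 1, 0%N; [apply: isom_cball0; exact: root_verts|].
by exists 0 => _ [r _ <-]; apply: exprn_ge0; rewrite invr_ge0.
Qed.

Let balls_isom_le c1 c2 r s : (s <= r)%N -> balls_isom c1 c2 r -> balls_isom c1 c2 s.
Proof. by move=> sr; apply: isom_cball_le => //; exact: root_verts. Qed.

Let half_cvg (e : R) : 0 < e -> exists r : nat, 2^-1 ^+ r < e.
Proof.
move=> e0; have h1 : `|2^-1| < 1 :> R.
  by rewrite ger0_norm ?invr_ge0// invf_lt1// ltr1n.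
have /cvgr0Pnorm_lt/(_ _ e0)[N _ NP] := cvg_expr h1.
by exists N; apply: le_lt_trans (NP N _) => //=; exact: ler_norm.
Qed.

Let SCdist_le c1 c2 r : balls_isom c1 c2 r -> SCdist c1 c2 <= 2^-1 ^+ r.
Proof. by move=> B; apply: ge_inf; [case: (A_inf c1 c2)|exists r]. Qed.

Let SCdist_ltP c1 c2 (e : R) : SCdist c1 c2 < e ->
  exists2 r : nat, balls_isom c1 c2 r & 2^-1 ^+ r < e.
Proof.
move=> /(inf_lt (A_inf c1 c2).1) [_ [r B <-] re]; by exists r.
Qed.

Let SCdist_ge0 c1 c2 : 0 <= SCdist c1 c2.
Proof.
apply: lb_le_inf; first by case: (A_inf c1 c2).
by move=> _ [r _ <-]; apply: exprn_ge0; rewrite invr_ge0.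
Qed.

Let SCdistxx c : SCdist c c = 0.
Proof.
apply/eqP; rewrite eq_le SCdist_ge0 andbT leNgt; apply/negP => /half_cvg[r].
by apply/negP; rewrite -leNgt; apply: SCdist_le; exact: isom_refl.
Qed.

Let SCdist_positivity c1 c2 : SCdist c1 c2 = 0 -> c1 = c2.
Proof.
move=> d0; rewrite -(ireprK c1) -(ireprK c2); apply/iclassE.
apply: isom_all_cball; try exact: root_verts; try exact: rc_connected;
  try exact: rc_locally_finite.
move=> r; have /SCdist_ltP[s Bs sr] : SCdist c1 c2 < 2^-1 ^+ r.
  by rewrite d0 exprn_gt0// invr_gt0.
apply: balls_isom_le Bs; rewrite leqNgt; apply/negP => /ltnW rs.
move: sr; rewrite ltNge => /negP; apply.
by apply: ler_wiXn2l; rewrite ?invr_ge0// invf_le1// ler1n.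
Qed.

Let SCdist_sym c1 c2 : SCdist c1 c2 = SCdist c2 c1.
Proof.
congr inf; rewrite /balls_isom; apply/seteqP.
by split=> _ [r B <-]; exists r => //; apply: isom_sym B; apply/verts_cball;
  [exact: root_verts|exact: dist_le0|exact: root_verts|exact: dist_le0].
Qed.

Let SCdist_triangle c2 c1 c3 : SCdist c1 c3 <= SCdist c1 c2 + SCdist c2 c3.
Proof.
apply/ler_addgt0Pr => e e0.
have [r rB re] : exists2 r : nat, balls_isom c1 c2 r & 2^-1 ^+ r < SCdist c1 c2 + e.
  by apply: SCdist_ltP; rewrite ltrDl.
have [s sB se] : exists2 s : nat, balls_isom c2 c3 s & 2^-1 ^+ s < SCdist c2 c3 + e.
  by apply: SCdist_ltP; rewrite ltrDl.
have B : balls_isom c1 c3 (minn r s).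
  apply: isom_trans (balls_isom_le (geq_minl r s) rB) _.
  exact: balls_isom_le (geq_minr r s) sB.
apply: (le_trans (SCdist_le B)); rewrite /minn; case: ifP => _.
  by rewrite addrAC; apply: (le_trans (ltW re)); rewrite lerDl.
by rewrite -addrA; apply: (le_trans (ltW se)); rewrite lerDr.
Qed.

HB.instance Definition _ := isMetric.Build R (SC R)
  SCdistxx SCdist_positivity SCdist_sym SCdist_triangle.

End metric.

HB.instance Definition _ (R : realType) :=
  Measurable.copy (SC R) (g_sigma_algebraType (@open (SC R))).

Section random_complexes.
Variable R : realType.
Local Open Scope ereal_scope.

Definition deg (K : complex) (v : nat) : \bar R :=
  counting [set s | simp K 1 s /\ v \in s].

Definition deg_max (c : SC R) : \bar R :=
  ereal_sup [set deg (irepr c) v | v in verts (irepr c)].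

Definition degree (mu : {measure set (SC R) -> \bar R}) : \bar R :=
  ess_sup mu deg_max.

Definition weakly_cvg (mu_ : nat -> {measure set (SC R) -> \bar R})
    (mu : {measure set (SC R) -> \bar R}) : Prop :=
  forall f : SC R -> R, continuous f -> bounded_fun f ->
    \int[mu_ n]_c (f c)%:E @[n --> \oo] --> \int[mu]_c (f c)%:E.

End random_complexes.

Record fcomplex := FComplex {
  fc_complex :> complex ;
  fc_finite : finite_set fc_complex }.

Definition fverts (K : fcomplex) : {fset nat} := fset_set (verts K).

Section component_of_finite.
Variable K : fcomplex.

Lemma finite_verts : finite_set (verts K).
Proof.
have /finite_fsetP[A KA] := fc_finite K.
have : finite_set (\bigcup_(s in [set` A]) [set` s]).
  by apply: bigcup_finite => [|s _]; exact: finite_fset.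
apply: sub_finite_set => v Kv; exists [fset v]%fset; last by rewrite /= inE.
by rewrite -KA.
Qed.

Lemma fverts_verts (x : fverts K) : verts K (\val x).
Proof. by have := valP x; rewrite in_fset_set ?inE//; exact: finite_verts. Qed.

Variable x : fverts K.
Let X := component K (\val x).

Let X_root : verts X (\val x).
Proof.
apply/verts_full_sub; split; first exact: fverts_verts.
by exists 0%N; exact: dist_le0.
Qed.

Let X_dist r v : dist_le K r (\val x) v -> dist_le X r (\val x) v.
Proof.
move: r v; apply: dist_le_ind => [r|r u v du IH a]; first exact: dist_le0.
apply: dist_leS IH _; case: (a) => uv Kuv; split=> //; split=> // w.
rewrite !inE => /orP[] /eqP ->; first by exists r.
by exists r.+1; exact: dist_leS du a.
Qed.

Let X_connected : connected_cplx X.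
Proof.
split; first by exists (\val x).
move=> u v /verts_full_sub[_ [r /X_dist xu]] /verts_full_sub[_ [s /X_dist xv]].
by exists (r + s)%N; exact: dist_le_trans (dist_le_sym xu) xv.
Qed.

Let X_locally_finite : locally_finite X.
Proof.
by move=> v _; apply: (sub_finite_set _ (fc_finite K)) => s [[]].
Qed.

Definition rooted_component : rcomplex :=
  RComplex X_root X_connected X_locally_finite.

End component_of_finite.

Section empirical_measure.
Variables (R : realType) (K : fcomplex).
Local Open Scope ereal_scope.

Definition empirical (A : set (SC R)) : \bar R :=
  (#|` fverts K|%:R^-1)%:E *
  \sum_(x : fverts K) \d_(iclass (rooted_component x) : SC R) A.

Let empirical0 : empirical set0 = 0.
Proof. by rewrite /empirical big1 ?mule0// => x _; rewrite measure0. Qed.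

Let empirical_ge0 A : 0 <= empirical A.
Proof. by apply: mule_ge0; [rewrite lee_fin invr_ge0|exact: sume_ge0]. Qed.

Let empirical_sigma_additive : semi_sigma_additive empirical.
Proof.
move=> F mF tF mUF; rewrite [X in _ --> X](_ : _ =
    lim ((fun n => \sum_(0 <= i < n) empirical (F i)) @ \oo)).
  exact: is_cvg_ereal_nneg_natsum.
rewrite /empirical nneseriesZl; last by move=> i _; exact: sume_ge0.
rewrite nneseries_sum//; congr (_ * _); apply: eq_bigr => x _.
exact: measure_semi_bigcup.
Qed.

HB.instance Definition _ := isMeasure.Build _ _ _ empirical
  empirical0 empirical_ge0 empirical_sigma_additive.

End empirical_measure.

Definition sofic (R : realType) (mu : {measure set (SC R) -> \bar R}) : Prop :=
  exists K_ : nat -> fcomplex, (forall n, connected_cplx (K_ n)) /\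
    weakly_cvg (fun n => empirical (K_ n)) mu.

Section l2_chains.
Variables (R : realType) (K : complex).

(* A [p]-chain is given by its coefficients on the [p]-simplices of [K], each
   oriented by the increasing order of its vertices. *)
Definition chain : Type := {fset nat} -> R.

Definition l2chain (p : nat) : set chain :=
  [set f | (forall s, ~ simp K p s -> f s = 0) /\
           summable [set: {fset nat}] (fun s => (f s ^+ 2)%:E)].

Definition dot (f g : chain) : R :=
  let h := (fun s => (f s * g s)%:E) in
  fine (\esum_(s in [set: {fset nat}]) h^\+ s
        - \esum_(s in [set: {fset nat}]) h^\- s)%E.

Definition basis_chain (s : {fset nat}) : chain := fun t => (t == s)%:R.

(* The coefficient of [t] in the boundary of the oriented simplex
   [s = [v_0 < ... < v_p]]: it is [(-1) ^ i] if [t = s \ v_i]. *)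
Definition incidence (s t : {fset nat}) : R :=
  \sum_(v <- s | (s `\ v)%fset == t) (-1) ^+ #|` [fset w in s | (w < v)%N]%fset|.

(* The simplicial boundary, from [l2chain p] to [l2chain p.-1]; in degree 0 it
   is the zero map. *)
Definition bd (p : nat) (f : chain) : chain := fun t =>
  if p is 0 then 0 else \sum_(s \in simp K p) incidence s t * f s.

(* The Hilbert space adjoint of an operator [T] with domain [C]; such an [h] is
   unique, and it exists when [T] is bounded on [C]. *)
Definition adjoint (C : set chain) (T : chain -> chain) (g : chain) : chain :=
  xget (fun=> 0) [set h | C h /\ forall f, C f -> dot (T f) g = dot f h].

Definition bd_adj (p : nat) : chain -> chain := adjoint (l2chain p) (bd p).

Definition laplacian (p : nat) (f : chain) : chain :=
  bd_adj p (bd p f) + bd p.+1 (bd_adj p.+1 f).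

Definition harmonic_chain (p : nat) : set chain :=
  [set f | l2chain p f /\ laplacian p f = 0].

Definition orth_proj (W : set chain) (f : chain) : chain :=
  xget (fun=> 0) [set g | W g /\ forall w, W w -> dot (f - g) w = 0].

End l2_chains.

Definition betti_density (R : realType) (p : nat) (K : rcomplex) : R :=
  \sum_(s \in [set s | simp K p s /\ rc_root K \in s])
    dot (orth_proj (harmonic_chain K p) (basis_chain R s)) (basis_chain R s) / p.+1%:R.

(* The density is invariant under isomorphism, so any representative will do.
   The complexes of unbounded degree, on which [bd] need not be bounded, form a
   null set as soon as [degree mu] is finite. *)
Definition betti (R : realType) (p : nat) (mu : {measure set (SC R) -> \bar R}) : \bar R :=
  (\int[mu]_c (betti_density R p (irepr c))%:E)%E.

(* Main.v *)
(* This is Lueck approximation, organised so that spectral theory is needed only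
   for finite matrices.  Fix [d] bounding all degrees, and let [L] be the Hodge
   Laplacian on [p]-chains of the full subcomplex of the vertices of degree at
   most [d].  With [C] at least the norm of [L], the operator [S = 1 - L / C] is
   a contraction, and [<S^2k s, s> = |S^k s|^2] decreases to [<P s, s>] as [k]
   grows, where [P] is the projection onto the harmonic chains.  Summing over the
   [p]-simplices at the root gives a function [heatf k] of the rooted complex
   which only depends on a ball around the root.  Hence [heatf k] is continuous
   and bounded, its integral is weakly continuous in the measure, and it remains
   to make the convergence in [k] uniform over sofic measures.  For a finite
   complex the integral of [heatf k] is a normalised trace of [S^2k].  The
   nonzero eigenvalues of [L] have product at least 1, since up to sign that
   product is a coefficient of the characteristic polynomial of an integer
   matrix, and they are at most [C].  So for each [q] a proportion at most [1 / q]
   of them lies below [C^(1-q)], and the others contribute at most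
   [(1 - C^(-q))^2k] each.  This bound passes to weak limits. *)
From HB Require Import structures.
Require Import Defs.
From mathcomp Require Import all_boot all_order all_algebra.
From mathcomp Require Import finmap algC.
From mathcomp Require spectral sesquilinear.
From mathcomp Require Import all_classical all_reals all_analysis.
From mathcomp Require Import measurable_realfun ess_sup_inf.
From mathcomp Require Import ring lra.

Set Implicit Arguments.
Unset Strict Implicit.
Unset Printing Implicit Defensive.
Import Order.TTheory GRing.Theory Num.Theory.
Import numFieldNormedType.Exports.
Local Open Scope classical_set_scope.

(** * Unconditional sums and the space of square-summable chains *)

(** [adjoint] and [orth_proj] select by [xget], so the selected objects must be shown to exist.
    Boundary operators are kernels with boundedly many entries in each row and column, and their
    adjoint is the transposed kernel. The projection of a chain is built as the pointwise limit of
    its even iterates under S: evenness makes the diagonal coefficients squared norms, hence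
    monotone.

    The obstacle is the exchange of the limits in time and in the sequence of measures. Monotonicity
    alone gives one inequality, upper semicontinuity. The arithmetic estimate behind the other one
    compares two heat times [k] and [j] and does not mention harmonic chains. It is thus an
    inequality between integrals of bounded continuous functions and survives the weak limit in the
    definition of soficity; only afterwards is [j] sent to infinity, for each measure separately.
    The eigenvalues are algebraic numbers, but the traces are rational, which carries the estimate
    over to the reals. *)

Section unconditional_sums.
Variables (R : realType) (I : choiceType).
Local Open Scope ring_scope.
Implicit Types (h a b : I -> R) (F : {fset I}).

(** Convergence of the net of finite partial sums. Linearity of [dot] follows from uniqueness of
    this limit, without handling the positive and negative parts through which [dot] is defined. *)
Definition is_sum h (x : R) := forall e, 0 < e ->
  exists F0, forall F, (F0 `<=` F)%fset -> `|x - \sum_(i <- F) h i| <= e.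

Lemma is_sum_unique h x y : is_sum h x -> is_sum h y -> x = y.
Proof.
move=> hx hy; apply/eqP; rewrite -subr_eq0 -normr_le0.
apply/ler_addgt0Pr => e e0; rewrite add0r.
have e2 : 0 < e / 2 by rewrite divr_gt0.
have [F0 h0] := hx _ e2; have [F1 h1] := hy _ e2.
have /h0 {}h0 := fsubsetUl F0 F1; have /h1 {}h1 := fsubsetUr F0 F1.
set z := \sum_(i <- (F0 `|` F1)%fset) h i in h0 h1.
apply: (le_trans (ler_distD z x y)); rewrite [leRHS](splitr e).
by apply: lerD => //; rewrite distrC.
Qed.

Lemma is_sumD h1 h2 x y : is_sum h1 x -> is_sum h2 y ->
  is_sum (fun i => h1 i + h2 i) (x + y).
Proof.
move=> hx hy e e0.
have e2 : 0 < e / 2 by rewrite divr_gt0.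
have [F0 h0] := hx _ e2; have [F1 h1'] := hy _ e2.
exists (F0 `|` F1)%fset => F FF.
have /h0 {}h0 := fsubset_trans (fsubsetUl F0 F1) FF.
have /h1' {}h1' := fsubset_trans (fsubsetUr F0 F1) FF.
rewrite big_split opprD addrACA [leRHS](splitr e).
by apply: (le_trans (ler_normD _ _)); exact: lerD.
Qed.

Lemma is_sumZ h c x : is_sum h x -> is_sum (fun i => c * h i) (c * x).
Proof.
move=> hx e e0.
have c0 : 0 < `|c| + 1 by rewrite ltr_wpDl.
have [F0 h0] := hx _ (divr_gt0 e0 c0); exists F0 => F /h0 h1.
rewrite -mulr_sumr -mulrBr normrM.
apply: (@le_trans _ _ ((`|c| + 1) * (e / (`|c| + 1)))); last first.
  by rewrite mulrC divfK// gt_eqF.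
by apply: ler_pM => //; rewrite lerDl.
Qed.

Lemma is_sum_fin h F : (forall i, i \notin F -> h i = 0) ->
  is_sum h (\sum_(i <- F) h i).
Proof.
move=> hF e e0; exists F => G FG.
rewrite (big_fset_incl _ FG)/=; first by rewrite subrr normr0 ltW.
by move=> i _ /hF.
Qed.

Lemma le_sum_fset a F G : (forall i, 0 <= a i) -> (F `<=` G)%fset ->
  \sum_(i <- F) a i <= \sum_(i <- G) a i.
Proof.
move=> a0 FG; rewrite (big_fsetID _ (mem F) G)/=.
rewrite [X in X + _](_ : _ = \sum_(i <- F) a i); last first.
  apply: eq_fbigl => i; rewrite !inE/=.
  by apply/andP/idP => [[]//|iF]; split => //; exact: (fsubsetP FG).
by rewrite lerDl; apply: sumr_ge0.
Qed.

Lemma esum_fsetP a M : (forall F, \sum_(i <- F) a i <= M) ->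
  (\esum_(i in [set: I]) (a i)%:E <= M%:E)%E.
Proof.
move=> aM; apply: ge_ereal_sup => _ [X [finX _] <-].
by rewrite fsbig_finite// sumEFin lee_fin.
Qed.

Lemma le_fset_esum a F : (forall i, 0 <= a i) ->
  ((\sum_(i <- F) a i)%:E <= \esum_(i in [set: I]) (a i)%:E)%E.
Proof.
move=> a0; apply: esum_ge; exists [set` F]; first by split.
by rewrite fsbig_finite// sumEFin lee_fin set_fsetK.
Qed.

Lemma is_sum_esum a : (forall i, 0 <= a i) ->
  (\esum_(i in [set: I]) (a i)%:E < +oo)%E ->
  is_sum a (fine (\esum_(i in [set: I]) (a i)%:E)).
Proof.
move=> a0 aoo e e0.
have afin : (\esum_(i in [set: I]) (a i)%:E)%E \is a fin_num.
  by rewrite ge0_fin_numE//; apply: esum_ge0 => i _; rewrite lee_fin.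
have [_ [X [finX _] <-]] := ub_ereal_sup_adherent e0 afin.
rewrite fsbig_finite// sumEFin -[ereal_sup _]/(esum _ _).
rewrite -(fineK afin) -EFinB lte_fin => Xe.
exists (fset_set X) => F XF.
have := le_fset_esum F a0; rewrite -(fineK afin) lee_fin => Fs.
rewrite ger0_norm ?subr_ge0// lerBlDr -lerBlDl.
by apply/ltW/(lt_le_trans Xe); exact: le_sum_fset.
Qed.

(** The expression inside [dot], isolated so that [is_sum_rsum] applies to [dot] by conversion. *)
Definition rsum (h : I -> R) : R :=
  fine (\esum_(i in [set: I]) (EFin \o h)^\+ i -
        \esum_(i in [set: I]) (EFin \o h)^\- i)%E.

Lemma is_sum_rsum h : summable [set: I] (EFin \o h) -> is_sum h (rsum h).
Proof.
move=> sh.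
pose p i := Num.max (h i) 0; pose n i := Num.max (- h i) 0.
have p0 i : 0 <= p i by rewrite le_max lexx orbT.
have n0 i : 0 <= n i by rewrite le_max lexx orbT.
have pE : ((EFin \o h)^\+)%E = EFin \o p.
  by apply/funext => i; rewrite funeposE /= -EFin_max.
have nE : ((EFin \o h)^\-)%E = EFin \o n.
  by apply/funext => i; rewrite funenegE /= -EFin_max.
have fp : (\esum_(i in [set: I]) (p i)%:E < +oo)%E.
  have := summable_funepos sh; rewrite pE /summable; congr (_ < _)%E.
  by apply: eq_esum => i _ /=; rewrite ger0_norm.
have fn : (\esum_(i in [set: I]) (n i)%:E < +oo)%E.
  have := summable_funeneg sh; rewrite nE /summable; congr (_ < _)%E.
  by apply: eq_esum => i _ /=; rewrite ger0_norm.
have Fp : (\esum_(i in [set: I]) (p i)%:E)%E \is a fin_num.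
  by rewrite ge0_fin_numE//; apply: esum_ge0 => i _; rewrite lee_fin.
have Fn : (\esum_(i in [set: I]) (n i)%:E)%E \is a fin_num.
  by rewrite ge0_fin_numE//; apply: esum_ge0 => i _; rewrite lee_fin.
rewrite /rsum pE nE fineB//= -mulN1r.
rewrite [X in is_sum X](_ : _ = fun i => p i + -1 * n i); last first.
  apply/funext => i; rewrite /p /n.
  by have [h1|h1] := leP (h i) 0; have [h2|h2] := leP (- h i) 0; lra.
by apply: is_sumD; [|apply: is_sumZ]; exact: is_sum_esum.
Qed.

Lemma is_sum_ge0 h x : (forall i, 0 <= h i) -> is_sum h x ->
  forall F, \sum_(i <- F) h i <= x.
Proof.
move=> h0 hx F; apply/ler_addgt0Pr => e /hx[F0 /(_ _ (fsubsetUl F0 F))].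
rewrite ler_norml => /andP[+ _]; rewrite lerBrDl addrC => xe.
have /(le_trans _) := le_sum_fset h0 (fsubsetUr F0 F).
by move=> /(_ _ (lexx _)) /le_trans; apply; lra.
Qed.

End unconditional_sums.

Section l2_space.
Variable R : realType.
Local Open Scope ring_scope.
Local Notation I := {fset nat}.
Implicit Types (f g h w : chain R) (F : {fset {fset nat}}) (a : R).

Definition l2 f := summable [set: I] (fun s => (f s ^+ 2)%:E).

Lemma l2P f : l2 f <-> exists M, forall F, \sum_(s <- F) f s ^+ 2 <= M.
Proof.
have sq0 s : 0 <= f s ^+ 2 by exact: sqr_ge0.
have -> : l2 f = (\esum_(s in [set: I]) (f s ^+ 2)%:E < +oo)%E.
  rewrite /l2 /summable; congr (_ < _)%E.
  by apply: eq_esum => s _ /=; rewrite ger0_norm.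
split=> [foo|[M fM]]; last first.
  by apply: le_lt_trans (esum_fsetP fM) _; rewrite ltry.
exists (fine (\esum_(s in [set: I]) (f s ^+ 2)%:E)%E) => F.
rewrite -lee_fin fineK; first exact: le_fset_esum.
by rewrite ge0_fin_numE//; apply: esum_ge0 => s _; rewrite lee_fin.
Qed.

Lemma l2_fin f F : (forall s, s \notin F -> f s = 0) -> l2 f.
Proof.
move=> fF; apply/l2P; exists (\sum_(s <- F) f s ^+ 2) => G.
apply: (is_sum_ge0 (fun=> sqr_ge0 _)); apply: is_sum_fin => s /fF ->.
by rewrite expr0n.
Qed.

Lemma l2_basis s : l2 (basis_chain R s).
Proof.
apply: (@l2_fin _ [fset s]%fset) => t; rewrite inE /basis_chain.
by move=> /negbTE ->.
Qed.

Lemma l20 : l2 0.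
Proof. by apply: (@l2_fin _ fset0). Qed.

Lemma l2D f g : l2 f -> l2 g -> l2 (f + g).
Proof.
move=> /l2P[M fM] /l2P[N gN]; apply/l2P; exists (2 * (M + N)) => F.
apply: (@le_trans _ _ (2 * (\sum_(s <- F) f s ^+ 2 + \sum_(s <- F) g s ^+ 2))).
  rewrite -big_split mulr_sumr /=; apply: ler_sum => s _.
  by rewrite -[(f + g) s]/(f s + g s); have := sqr_ge0 (f s - g s); rewrite !expr2; lra.
by rewrite ler_pM2l// lerD.
Qed.

Lemma l2Z a f : l2 f -> l2 (a *: f).
Proof.
move=> /l2P[M fM]; apply/l2P; exists (a ^+ 2 * M) => F.
rewrite (eq_bigr (fun s => a ^+ 2 * f s ^+ 2)) => [|s _]; last first.
  by rewrite -exprMn.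
by rewrite -mulr_sumr ler_wpM2l ?sqr_ge0.
Qed.

Lemma l2B f g : l2 f -> l2 g -> l2 (f - g).
Proof. by move=> lf /(@l2Z (-1)); rewrite scaleN1r; exact: l2D. Qed.

Lemma is_sum_dot f g : l2 f -> l2 g ->
  is_sum (fun s => f s * g s) (dot f g).
Proof.
move=> lf lg; apply: is_sum_rsum.
have [M fgM] := (l2P f).1 lf; have [N gN] := (l2P g).1 lg.
apply: (@le_lt_trans _ _ (M + N)%:E); last by rewrite ltry.
apply: esum_fsetP => F.
apply: (@le_trans _ _ (\sum_(s <- F) f s ^+ 2 + \sum_(s <- F) g s ^+ 2)).
  rewrite -big_split /=; apply: ler_sum => s _.
  rewrite normrM -(real_normK (num_real (f s))) -(real_normK (num_real (g s))).
  have := sqr_ge0 (`|f s| - `|g s|); have := sqr_ge0 (`|f s| + `|g s|).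
  by rewrite !expr2; lra.
exact: lerD.
Qed.

Lemma dot_unique f g x : l2 f -> l2 g -> is_sum (fun s => f s * g s) x ->
  dot f g = x.
Proof. by move=> lf lg; apply: is_sum_unique; exact: is_sum_dot. Qed.

Lemma dotC f g : dot f g = dot g f.
Proof.
rewrite /dot; have -> : (fun s => (f s * g s)%:E) = (fun s => (g s * f s)%:E) => //.
by apply/funext => s; rewrite mulrC.
Qed.

Lemma dotDl f g h : l2 f -> l2 g -> l2 h -> dot (f + g) h = dot f h + dot g h.
Proof.
move=> lf lg lh; apply: dot_unique => //; first exact: l2D.
rewrite [X in is_sum X](_ : _ = fun s => f s * h s + g s * h s); last first.
  by apply/funext => s; rewrite -mulrDl.
by apply: is_sumD; exact: is_sum_dot.
Qed.

Lemma dotZl a f h : l2 f -> l2 h -> dot (a *: f) h = a * dot f h.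
Proof.
move=> lf lh; apply: dot_unique => //; first exact: l2Z.
rewrite [X in is_sum X](_ : _ = fun s => a * (f s * h s)); last first.
  by apply/funext => s; rewrite mulrA.
by apply: is_sumZ; exact: is_sum_dot.
Qed.

Lemma dotBl f g h : l2 f -> l2 g -> l2 h -> dot (f - g) h = dot f h - dot g h.
Proof.
by move=> lf lg lh; rewrite -scaleN1r dotDl ?dotZl ?mulN1r//; exact: l2Z.
Qed.

Lemma dotDr f g h : l2 f -> l2 g -> l2 h -> dot h (f + g) = dot h f + dot h g.
Proof. by move=> *; rewrite ![dot h _]dotC dotDl. Qed.

Lemma dotBr f g h : l2 f -> l2 g -> l2 h -> dot h (f - g) = dot h f - dot h g.
Proof. by move=> *; rewrite ![dot h _]dotC dotBl. Qed.

Lemma dotZr a f h : l2 f -> l2 h -> dot h (a *: f) = a * dot h f.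
Proof. by move=> *; rewrite ![dot h _]dotC dotZl. Qed.

Lemma dot0l h : l2 h -> dot 0 h = 0.
Proof. by move=> lh; rewrite -(scale0r 0) dotZl ?mul0r//; exact: l20. Qed.

Lemma dot_fin f g F : l2 g -> (forall s, s \notin F -> f s = 0) ->
  dot f g = \sum_(s <- F) f s * g s.
Proof.
move=> lg fF; apply: dot_unique => //; first exact: l2_fin fF.
by apply: is_sum_fin => s /fF ->; rewrite mul0r.
Qed.

Lemma dot_basisl s f : l2 f -> dot (basis_chain R s) f = f s.
Proof.
move=> lf; rewrite (@dot_fin _ _ [fset s]%fset)//; last first.
  by move=> t; rewrite inE /basis_chain => /negbTE ->.
by rewrite big_seq_fset1 /basis_chain eqxx mul1r.
Qed.

Lemma dot_basisr s f : l2 f -> dot f (basis_chain R s) = f s.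
Proof. by rewrite dotC; exact: dot_basisl. Qed.

Lemma le_sum_sqr_dot f F : l2 f -> \sum_(s <- F) f s ^+ 2 <= dot f f.
Proof.
move=> lf; apply: is_sum_ge0; first by move=> s; exact: sqr_ge0.
exact: is_sum_dot.
Qed.

Lemma dot_ge0 f : l2 f -> 0 <= dot f f.
Proof. by move=> /(le_sum_sqr_dot fset0); rewrite big_seq_fset0. Qed.

Lemma dot_le f M : l2 f -> (forall F, \sum_(s <- F) f s ^+ 2 <= M) ->
  dot f f <= M.
Proof.
move=> lf fM; apply/ler_addgt0Pr => e e0.
have [F /(_ F (fsubset_refl F))] := is_sum_dot lf lf e0.
rewrite ler_norml => /andP[_]; rewrite lerBlDl => /le_trans; apply.
by rewrite lerD2r.
Qed.

(** Expansion of the squared norm of [a *: f - g], divided by [a]. This is Cauchy-Schwarz with a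
    free weight, chosen at each use; it keeps square roots of [dot] out of the estimates. *)
Lemma dot_amgm a f g : 0 < a -> l2 f -> l2 g ->
  2 * `|dot f g| <= a * dot f f + a^-1 * dot g g.
Proof.
move=> a0 lf lg.
wlog fg0 : f lf / 0 <= dot f g => [wf|].
  have [fg0|fg0] := leP 0 (dot f g); first exact: wf.
  have lmf := l2Z (-1) lf.
  have := wf _ lmf; rewrite dotZl// (dotZl _ lf)// (dotZr _ lf)//.
  by rewrite !mulN1r opprK normrN; apply; rewrite oppr_ge0 ltW.
rewrite ger0_norm//.
have laf := l2Z a lf; have lafg := l2B laf lg.
have := dot_ge0 lafg.
rewrite (dotBl laf)// (dotBr laf)// (dotBr laf)// !(dotZl _ lf)// !(dotZr _ lf)//.
rewrite (dotC g f) => h.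
have : 0 <= a^-1 * (a * (a * dot f f) - a * dot f g - (a * dot f g - dot g g)).
  by rewrite mulr_ge0// invr_ge0 ltW.
by rewrite !mulrBr !mulKf ?gt_eqF//; lra.
Qed.

Definition restr F f : chain R := fun s => if s \in F then f s else 0.

Lemma l2_restr F f : l2 (restr F f).
Proof. by apply: (@l2_fin _ F) => s /negbTE; rewrite /restr => ->. Qed.

Lemma dot_restrl F f g : l2 g -> dot (restr F f) g = \sum_(s <- F) f s * g s.
Proof.
move=> lg; rewrite (@dot_fin _ _ F)//; last by move=> s; rewrite /restr => /negbTE ->.
by apply: eq_big_seq => s sF; rewrite /restr sF.
Qed.

(** The squared norm of the tail outside [F] is exactly the error of the partial sum over [F] in
    [dot f f]. *)
Lemma dot_tail f e : l2 f -> 0 < e ->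
  exists F, dot (f - restr F f) (f - restr F f) <= e.
Proof.
move=> lf e0; have lr F := l2_restr F f.
have [F Fe] := is_sum_dot lf lf e0; exists F.
have /Fe := fsubset_refl F; apply: le_trans.
have lfr := l2B lf (lr F).
rewrite (dotBl lf)// (dotBr lf)// (dotBr lf)//.
rewrite (dotC f) !dot_restrl//.
rewrite (_ : \sum_(s <- F) f s * restr F f s = \sum_(s <- F) f s * f s).
  by rewrite subrr subr0; exact: ler_norm.
by apply: eq_big_seq => s sF; rewrite /restr sF.
Qed.

Lemma cvg_fset_sum (u : nat -> I -> R) (l : I -> R) F :
  (forall s, u k s @[k --> \oo] --> l s) ->
  \sum_(s <- F) u k s @[k --> \oo] --> \sum_(s <- F) l s.
Proof.
move=> ul; elim: (F : seq _) => [|s r IH].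
  rewrite big_nil [X in X @ _](_ : _ = fun=> 0); first exact: cvg_cst.
  by apply/funext => k; rewrite big_nil.
rewrite big_cons [X in X @ _](_ : _ = fun k => u k s + \sum_(t <- r) u k t).
  exact: cvgD.
by apply/funext => k; rewrite big_cons.
Qed.

(** Fatou's lemma for the counting measure: each finite partial sum passes to the limit under the
    bound [M]. *)
Lemma l2_pointwise_lim (u : nat -> chain R) h M :
  (forall k, l2 (u k)) -> (forall k, dot (u k) (u k) <= M) ->
  (forall s, u k s @[k --> \oo] --> h s) ->
  l2 h /\ dot h h <= M.
Proof.
move=> lu uM uh; have hM F : \sum_(s <- F) h s ^+ 2 <= M.
  have cv : \sum_(s <- F) u k s ^+ 2 @[k --> \oo] --> \sum_(s <- F) h s ^+ 2.
    by apply: cvg_fset_sum => s; exact: cvgM.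
  rewrite -(cvg_lim _ cv)//; apply: limr_le; first by apply/cvg_ex; eexists; exact: cv.
  by apply: nearW => k; apply: le_trans (uM k); exact: le_sum_sqr_dot.
have lh : l2 h by apply/l2P; exists M.
by split=> //; exact: dot_le.
Qed.

(** On a finite part of [w] pointwise convergence suffices, and the rest of [w] is small in norm
    while [u k] stays bounded. *)
Lemma l2_weak_cvg (u : nat -> chain R) h M w :
  (forall k, l2 (u k)) -> (forall k, dot (u k) (u k) <= M) ->
  (forall s, u k s @[k --> \oo] --> h s) -> l2 w ->
  dot (u k) w @[k --> \oo] --> dot h w.
Proof.
move=> lu uM uh lw; have [lh hM] := l2_pointwise_lim lu uM uh.
have M0 : 0 <= M by exact: le_trans (dot_ge0 (lu 0%N)) (uM 0%N).
apply/cvgrPdist_le => e e0.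
(* The weight for [dot_amgm]: the squared norm of [h - u k] is at most [4 * M], so its term is at
   most [e / 2]; the tail of [w] is cut at [a * e / 2] to make the other term at most [e / 2]. The
   [+ 1] covers [M = 0]. *)
pose a := e / (8 * (M + 1)).
have a0 : 0 < a by rewrite divr_gt0// mulr_gt0//; lra.
have ae0 : 0 < a * e / 2 by rewrite divr_gt0// mulr_gt0.
have [F Fe] := dot_tail lw ae0; set w' := w - restr F w in Fe.
have lw' : l2 w' by apply: l2B => //; exact: l2_restr.
have wE : w = restr F w + w' by rewrite /w' addrC subrK.
have cv : \sum_(s <- F) w s * u k s @[k --> \oo] --> \sum_(s <- F) w s * h s.
  by apply: cvg_fset_sum => s; apply: cvgM; [exact: cvg_cst|exact: uh].
have /cvgrPdist_le/(_ (e / 2)) := cv; rewrite divr_gt0// => /(_ isT).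
apply: filterS => k.
have lr := l2_restr F w; have luk := lu k.
rewrite -(dot_restrl F w lh) -(dot_restrl F w luk) [in X in _ -> X]wE.
rewrite (dotDr lr lw' lh) (dotDr lr lw' luk) !(dotC (restr F w)) => h1.
have h2 : 2 * `|dot (h - u k) w'| <= e.
  apply: le_trans (dot_amgm a0 (l2B lh (lu k)) lw') _.
  have d4 : dot (h - u k) (h - u k) <= 4 * M.
    have lD := l2D lh luk; have lB := l2B lh luk.
    have := dot_ge0 lD.
    rewrite (dotBl lh)// !(dotBr lh)// (dotDl lh)// !(dotDr lh)// (dotC (u k) h).
    by have := uM k; lra.
  have h3 : a * dot (h - u k) (h - u k) <= e / 2.
    apply: (@le_trans _ _ (a * (4 * (M + 1)))).
      by rewrite ler_pM2l//; lra.
    rewrite (_ : a * _ = e / 2)//.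
    by rewrite /a; field; rewrite gt_eqF//; lra.
  have h4 : a^-1 * dot w' w' <= e / 2.
    by rewrite ler_pdivrMl// mulrA.
  by rewrite [leRHS](splitr e) lerD.
rewrite opprD addrACA -(dotBl lh luk lw').
apply: (le_trans (ler_normD _ _)).
rewrite [leRHS](splitr e); apply: lerD => //.
by move: h2; lra.
Qed.

End l2_space.

(** * Kernels with finite rows and columns *)

Section kernels.
Variable R : realType.
Local Open Scope ring_scope.
Local Notation I := {fset nat}.
Implicit Types (f g h w : chain R) (F : {fset {fset nat}}) (B : I -> I -> R).
Implicit Types c : nat.

Lemma sqr_sum_le (T : Type) (r : seq T) (x : T -> R) :
  (\sum_(i <- r) x i) ^+ 2 <= (size r)%:R * \sum_(i <- r) x i ^+ 2.
Proof.
rewrite expr2 big_distrlr /=.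
apply: (@le_trans _ _ (\sum_(i <- r) \sum_(j <- r) (x i ^+ 2 + x j ^+ 2) / 2)).
  apply: ler_sum => i _; apply: ler_sum => j _.
  by have := sqr_ge0 (x i - x j); rewrite !expr2; lra.
have szE a : \sum_(i <- r) a = (size r)%:R * a :> R.
  by rewrite big_const_seq count_predT iter_addr_0 mulr_natl.
rewrite (eq_bigr (fun i => (size r)%:R * x i ^+ 2 / 2 +
    (\sum_(j <- r) x j ^+ 2) / 2)) => [|i _]; last first.
  by rewrite -mulr_suml big_split /= szE mulrDl.
by rewrite big_split /= szE -mulr_suml -mulr_sumr; lra.
Qed.

(** A single constant for rows and columns makes the class stable under transposition; the operator
    norm on l2 is then at most [c]. *)
Definition bker c B := [/\ forall s t, `|B s t| <= 1,
  forall s, exists2 F, (#|` F| <= c)%N & forall t, B s t != 0 -> t \in F &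
  forall t, exists2 F, (#|` F| <= c)%N & forall s, B s t != 0 -> s \in F].

Definition trk B : I -> I -> R := fun s t => B t s.

(* The sum is [0] by convention when its support is infinite; [bker] excludes this. *)
Definition kapp B f : chain R := fun s => \sum_(t \in [set: I]) B s t * f t.

Lemma bker_tr c B : bker c B -> bker c (trk B).
Proof. by case=> h1 h2 h3; split=> // s t; exact: h1. Qed.

Lemma kapp_supp B f s F : (forall t, B s t * f t != 0 -> t \in F) ->
  kapp B f s = \sum_(t <- F) B s t * f t.
Proof.
move=> BF; rewrite /kapp -(fsbig_widen [set` F] setT)//.
  by rewrite -fsbig_seq.
by move=> t [_ tF]; apply/eqP; apply: contra_notT tF => /BF.
Qed.

Lemma kapp_fin B f s F : (forall t, B s t != 0 -> t \in F) ->
  kapp B f s = \sum_(t <- F) B s t * f t.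
Proof. by move=> BF; apply: kapp_supp => t; rewrite mulf_eq0 negb_or => /andP[/BF]. Qed.

Variables (c : nat) (B : I -> I -> R).
Hypothesis bB : bker c B.

Let Brow s : exists2 F, (#|` F| <= c)%N & forall t, B s t != 0 -> t \in F.
Proof. by case: bB. Qed.

Lemma kappD f g : kapp B (f + g) = kapp B f + kapp B g.
Proof.
apply/funext => s; have [F _ FP] := Brow s.
rewrite -[RHS]/(kapp B f s + kapp B g s) !(kapp_fin _ FP) -big_split /=.
by apply: eq_bigr => t _; rewrite -mulrDr.
Qed.

Lemma kappZ a f : kapp B (a *: f) = a *: kapp B f.
Proof.
apply/funext => s; have [F _ FP] := Brow s.
rewrite -[RHS]/(a * kapp B f s) !(kapp_fin _ FP) mulr_sumr.
by apply: eq_bigr => t _; rewrite mulrCA.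
Qed.

Lemma kapp_cvg (u : nat -> chain R) h :
  (forall s, u k s @[k --> \oo] --> h s) ->
  forall s, kapp B (u k) s @[k --> \oo] --> kapp B h s.
Proof.
move=> uh s; have [F _ FP] := Brow s.
rewrite (kapp_fin _ FP) [X in X @ _](_ : _ = fun k => \sum_(t <- F) B s t * u k t).
  by apply: cvg_fset_sum => t; apply: cvgM; [exact: cvg_cst|exact: uh].
by apply/funext => k; rewrite (kapp_fin _ FP).
Qed.

(** Schur's test: Cauchy-Schwarz inside a row costs one factor [c], and after exchanging the sums
    each [f t ^+ 2] is counted at most [c] times by its column. *)
Lemma kapp_bound f F : l2 f ->
  \sum_(s <- F) kapp B f s ^+ 2 <= (c ^ 2)%:R * dot f f.
Proof.
move=> lf; have [B1 _ Bcol] := bB.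
pose b s t : R := (B s t != 0)%:R.
have /choice[N NP] s : exists N, (#|` N| <= c)%N /\ forall t, B s t != 0 -> t \in N.
  by have [N ? ?] := Brow s; exists N.
(* A common finite index set for all rows in [F], so that the double sum can be exchanged. *)
pose G := (\bigcup_(s <- F) N s)%fset.
apply: (@le_trans _ _ (\sum_(s <- F) c%:R * \sum_(t <- G) b s t * f t ^+ 2)).
  rewrite !big_seq; apply: ler_sum => s sF; have [Nc NB] := NP s.
  rewrite (kapp_fin _ NB); apply: (le_trans (sqr_sum_le _ _)).
  apply: ler_pM; rewrite ?ler0n ?ler_nat//.
    by apply: sumr_ge0 => t _; exact: sqr_ge0.
  apply: (@le_trans _ _ (\sum_(t <- N s) b s t * f t ^+ 2)); last first.
    apply: le_sum_fset; first by move=> t; rewrite mulr_ge0// sqr_ge0.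
    by apply/fsubsetP => t tN; apply/bigfcupP; exists s => //; rewrite sF.
  apply: ler_sum => t _; rewrite exprMn /b.
  have [->|B0] /= := eqVneq; first by rewrite expr0n !mul0r.
  rewrite ler_wpM2r ?sqr_ge0// -real_normK ?num_real//.
  by rewrite expr_le1// B1.
rewrite -mulr_sumr -mulnn natrM -mulrA ler_wpM2l ?ler0n//.
rewrite exchange_big /=.
apply: (@le_trans _ _ (\sum_(t <- G) c%:R * f t ^+ 2)); last first.
  by rewrite -mulr_sumr ler_wpM2l ?ler0n// le_sum_sqr_dot.
apply: ler_sum => t _; rewrite -mulr_suml ler_wpM2r ?sqr_ge0//.
have [H Hc HB] := Bcol t.
rewrite /b -natr_sum ler_nat; apply: leq_trans Hc.
rewrite -big_mkcond /= sum1_count -size_filter.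
apply: uniq_leq_size; first exact/filter_uniq/fset_uniq.
by move=> s; rewrite mem_filter => /andP[/HB].
Qed.

Lemma kapp_l2 f : l2 f -> l2 (kapp B f).
Proof. by move=> lf; apply/l2P; eexists => F; exact: kapp_bound. Qed.

Lemma dot_kapp_le f : l2 f -> dot (kapp B f) (kapp B f) <= (c ^ 2)%:R * dot f f.
Proof.
by move=> lf; apply: dot_le => [|F]; [exact: kapp_l2|exact: kapp_bound].
Qed.

Lemma kapp_basis s t : kapp B (basis_chain R s) t = B t s.
Proof.
have [F _ FP] := Brow t.
rewrite (@kapp_fin _ _ _ (s |` F)%fset) => [|u /FP uF]; last first.
  by rewrite !inE uF orbT.
rewrite (big_fsetD1 s) ?fset1U1//= /basis_chain eqxx mulr1.
rewrite big1_fset ?addr0// => u; rewrite !inE => /andP[/negbTE -> _].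
by rewrite mulr0.
Qed.

End kernels.

Section kernel_adjoint.
Variables (R : realType) (c : nat) (B : {fset nat} -> {fset nat} -> R).
Local Open Scope ring_scope.
Implicit Types (f g : chain R) (F : {fset {fset nat}}).
Hypothesis bB : bker c B.

Let bBt := bker_tr bB.

Lemma restrE F f : restr F f = \sum_(s <- F) f s *: basis_chain R s.
Proof.
apply/funext => t; rewrite fct_sumE /restr.
case: ifPn => tF.
  rewrite (big_fsetD1 t)//= -[(_ *: _) t]/(_ * _) /basis_chain eqxx mulr1.
  rewrite big1_fset ?addr0// => s; rewrite !inE => /andP[/negbTE st _].
  by rewrite -[(_ *: _) t]/(_ * _) eq_sym st mulr0.
rewrite big_seq big1// => s sF.
rewrite -[(_ *: _) t]/(_ * _) /basis_chain.
by case: eqP sF tF => [->->//|]; rewrite mulr0.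
Qed.

Let adjoint_basis s g : l2 g ->
  dot (kapp B (basis_chain R s)) g = kapp (trk B) g s.
Proof.
move=> lg; have [_ _ /(_ s)[F _ FP]] := bB.
rewrite (@kapp_fin _ (trk B) _ _ F)// (@dot_fin _ _ _ F)//.
  by apply: eq_bigr => t _; rewrite (kapp_basis bB).
move=> t tF; rewrite (kapp_basis bB).
by apply/eqP; apply: contraNT tF => /FP.
Qed.

Let adjoint_restr F f g : l2 g ->
  dot (kapp B (restr F f)) g = dot (restr F f) (kapp (trk B) g).
Proof.
move=> lg; have lBg := kapp_l2 bBt lg.
rewrite dot_restrl// restrE; elim: (F : seq _) => [|s r IH].
  rewrite !big_nil -(scale0r 0) (kappZ bB) scale0r; exact: dot0l.
have ls : l2 (f s *: basis_chain R s) by apply: l2Z; exact: l2_basis.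
have lr : l2 (\sum_(s <- r) f s *: basis_chain R s).
  elim: (r) => [|t q IHq]; first by rewrite big_nil; exact: l20.
  by rewrite big_cons; apply: l2D => //; apply: l2Z; exact: l2_basis.
rewrite !big_cons (kappD bB).
rewrite (dotDl (kapp_l2 bB ls) (kapp_l2 bB lr) lg) IH (kappZ bB).
by rewrite (dotZl _ (kapp_l2 bB (l2_basis R s)) lg) adjoint_basis.
Qed.

(** Exact for finitely supported [f] by linearity; for general [f] the discrepancy only involves a
    tail [w], on which both sides are small by boundedness. *)
Lemma kapp_adjoint f g : l2 f -> l2 g ->
  dot (kapp B f) g = dot f (kapp (trk B) g).
Proof.
move=> lf lg; have lBg := kapp_l2 bBt lg; have lBf := kapp_l2 bB lf.
apply/eqP; rewrite -subr_eq0 -normr_le0; apply/ler_addgt0Pr => e e0.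
rewrite add0r.
pose P : R := (c ^ 2)%:R + 1.
pose Q := dot g g + dot (kapp (trk B) g) (kapp (trk B) g).
have P0 : 0 < P by rewrite ltr_wpDl// ler0n.
have Q0 : 0 <= Q by rewrite addr_ge0// dot_ge0.
(* By [dot_amgm], twice the discrepancy is at most [a * P] times the squared norm of [w], plus
   [a^-1 * Q]. The tail is cut so that the first term is at most [a^-1], and
   [a^-1 * (1 + Q) = e]. *)
pose a := (1 + Q) / e.
have a0 : 0 < a by rewrite divr_gt0//; lra.
have d0 : 0 < a^-1 * a^-1 / P by rewrite divr_gt0// mulr_gt0// invr_gt0.
have [F Fd] := dot_tail lf d0; set w := f - restr F f in Fd.
have lr := l2_restr F f; have lw : l2 w by exact: l2B.
have lBw := kapp_l2 bB lw; have lBr := kapp_l2 bB lr.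
have fE : f = restr F f + w by rewrite /w addrC subrK.
have -> : dot (kapp B f) g - dot f (kapp (trk B) g) =
    dot (kapp B w) g - dot w (kapp (trk B) g).
  rewrite fE (kappD bB) (dotDl lBr lBw lg) (dotDl lr lw lBg) adjoint_restr//.
  by rewrite opprD addrACA subrr add0r.
have h1 := dot_amgm a0 lBw lg; have h2 := dot_amgm a0 lw lBg.
have h3 := dot_kapp_le bB lw.
have h4 : a * (P * dot w w) <= a^-1.
  rewrite -ler_pdivlMl// -ler_pdivlMl//.
  by apply: (le_trans Fd); rewrite mulrC.
have h5 : a * dot (kapp B w) (kapp B w) <= a * ((c ^ 2)%:R * dot w w).
  by rewrite ler_pM2l.
have h6 : a^-1 * (1 + Q) = e.
  by rewrite /a invf_div divfK// gt_eqF//; lra.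
apply: (le_trans (ler_normB _ _)).
have : a * (P * dot w w) = a * ((c ^ 2)%:R * dot w w) + a * dot w w.
  by rewrite /P; ring.
have : a^-1 * (1 + Q) = a^-1 + a^-1 * dot g g +
    a^-1 * dot (kapp (trk B) g) (kapp (trk B) g).
  by rewrite /Q; ring.
lra.
Qed.

End kernel_adjoint.

(** * The heat semigroup of the Hodge Laplacian *)

Section hodge_limit.
Variables (R : realType) (c : nat) (A E : {fset nat} -> {fset nat} -> R).
Local Open Scope ring_scope.
Implicit Types (f g h w : chain R) (F : {fset {fset nat}}).

Definition hodge f : chain R :=
  kapp (trk A) (kapp A f) + kapp E (kapp (trk E) f).

(* [2 * c ^ 2] bounds the norm of [hodge]: each of its two summands is a product
   of two operators of norm at most [c]. *)
Definition smooth f : chain R := f - (2 * c ^ 2)%:R^-1 *: hodge f.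

Hypothesis (c0 : (0 < c)%N) (bA : bker c A) (bE : bker c E).
Let bA' := bker_tr bA.
Let bE' := bker_tr bE.

Let C : R := (2 * c ^ 2)%:R.
Let C0 : 0 < C. Proof. by rewrite ltr0n muln_gt0/= expn_gt0 c0. Qed.

Lemma hodge_l2 f : l2 f -> l2 (hodge f).
Proof.
move=> lf; exact: l2D (kapp_l2 bA' (kapp_l2 bA lf)) (kapp_l2 bE (kapp_l2 bE' lf)).
Qed.

Lemma hodgeD f g : hodge (f + g) = hodge f + hodge g.
Proof.
by rewrite /hodge (kappD bA) (kappD bA') (kappD bE') (kappD bE) addrACA.
Qed.

Lemma hodgeZ a f : hodge (a *: f) = a *: hodge f.
Proof.
by rewrite /hodge (kappZ bA) (kappZ bA') (kappZ bE') (kappZ bE) scalerDr.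
Qed.

Lemma dot_hodge f g : l2 f -> l2 g -> dot (hodge f) g =
  dot (kapp A f) (kapp A g) + dot (kapp (trk E) f) (kapp (trk E) g).
Proof.
move=> lf lg; have lA := kapp_l2 bA lf; have lE := kapp_l2 bE' lf.
rewrite (dotDl (kapp_l2 bA' lA) (kapp_l2 bE lE) lg).
by rewrite (kapp_adjoint bA' lA lg) (kapp_adjoint bE lE lg).
Qed.

Lemma hodge_sym f g : l2 f -> l2 g -> dot (hodge f) g = dot f (hodge g).
Proof.
by move=> lf lg; rewrite [RHS]dotC !dot_hodge// dotC [X in _ + X]dotC.
Qed.

Lemma dot_hodge_ge0 f : l2 f -> 0 <= dot (hodge f) f.
Proof.
move=> lf; rewrite dot_hodge// addr_ge0// dot_ge0//.
  exact: (kapp_l2 bA).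
exact: (kapp_l2 bE').
Qed.

(** The squared norm of a sum is at most twice the sum of the squared norms, and the outer factor of
    each product has squared norm at most [c ^ 2]. This is the operator inequality L^2 <= C L, the
    form in which the norm of L is used. *)
Lemma sqr_hodge_le f : l2 f -> dot (hodge f) (hodge f) <= C * dot (hodge f) f.
Proof.
move=> lf; have lA := kapp_l2 bA lf; have lE := kapp_l2 bE' lf.
have lAA := kapp_l2 bA' lA; have lEE := kapp_l2 bE lE.
rewrite [X in _ <= C * X]dot_hodge//.
have h1 := dot_kapp_le bA' lA; have h2 := dot_kapp_le bE lE.
have := dot_ge0 (l2B lAA lEE).
have lD := l2D lAA lEE; have lB := l2B lAA lEE.
rewrite /hodge (dotBl lAA)// !(dotBr lAA)// (dotDl lAA)// !(dotDr lAA)//.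
rewrite (dotC (kapp E (kapp (trk E) f))).
rewrite /C natrM; lra.
Qed.

Lemma smooth_l2 f : l2 f -> l2 (smooth f).
Proof. by move=> lf; apply: l2B => //; apply: l2Z; exact: hodge_l2. Qed.

Lemma smoothD f g : smooth (f + g) = smooth f + smooth g.
Proof. by rewrite /smooth hodgeD scalerDr opprD addrACA. Qed.

Lemma smoothZ a f : smooth (a *: f) = a *: smooth f.
Proof. by rewrite /smooth hodgeZ scalerBr !scalerA mulrC. Qed.

Lemma smooth_sym f g : l2 f -> l2 g -> dot (smooth f) g = dot f (smooth g).
Proof.
move=> lf lg; have lLf := hodge_l2 lf; have lLg := hodge_l2 lg.
rewrite (dotBl lf (l2Z _ lLf) lg) (dotBr lg (l2Z _ lLg) lf).
by rewrite (dotZl _ lLf lg) (dotZr _ lLg lf) hodge_sym.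
Qed.

(** In the expansion, L^2 <= C L absorbs half of the cross term. Keeping the remaining energy term,
    rather than mere contraction, later shows that a chain whose norm is preserved is harmonic. *)
Lemma sqr_smooth_le f : l2 f ->
  dot (smooth f) (smooth f) <= dot f f - C^-1 * dot (hodge f) f.
Proof.
move=> lf; have lL := hodge_l2 lf; have lZ := l2Z C^-1 lL.
rewrite /smooth -/C (dotBl lf lZ (l2B lf lZ)) (dotBr lf lZ lf) (dotBr lf lZ lZ).
rewrite (dotC f) !(dotZl _ lL)// (dotZr _ lL)//.
have : C^-1 * (C^-1 * dot (hodge f) (hodge f)) <= C^-1 * dot (hodge f) f.
  by rewrite ler_pM2l ?invr_gt0// ler_pdivrMl// sqr_hodge_le.
lra.
Qed.

Lemma smooth_contr f : l2 f -> dot (smooth f) (smooth f) <= dot f f.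
Proof.
move=> lf; apply: le_trans (sqr_smooth_le lf) _.
by rewrite gerBl mulr_ge0 ?invr_ge0 ?(ltW C0)// dot_hodge_ge0.
Qed.

Lemma smooth_cvg (u : nat -> chain R) h :
  (forall s, u k s @[k --> \oo] --> h s) ->
  forall s, smooth (u k) s @[k --> \oo] --> smooth h s.
Proof.
move=> uh s; apply: cvgB; first exact: uh.
apply: cvgM; first exact: cvg_cst.
by apply: cvgD; [apply: (kapp_cvg bA')|apply: (kapp_cvg bE)] => t;
  [apply: (kapp_cvg bA)|apply: (kapp_cvg bE')].
Qed.

Lemma iter_smooth_l2 k f : l2 f -> l2 (iter k smooth f).
Proof. by move=> lf; elim: k => // k IH; exact: smooth_l2. Qed.

Lemma iter_smoothD k f g :
  iter k smooth (f + g) = iter k smooth f + iter k smooth g.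
Proof. by elim: k => // k IH; rewrite !iterS IH smoothD. Qed.

Lemma iter_smoothZ k a f : iter k smooth (a *: f) = a *: iter k smooth f.
Proof. by elim: k => // k IH; rewrite !iterS IH smoothZ. Qed.

Lemma iter_smooth_sym k f g : l2 f -> l2 g ->
  dot (iter k smooth f) g = dot f (iter k smooth g).
Proof.
move=> lf lg; elim: k g lg => // k IH g lg.
by rewrite iterS smooth_sym ?IH -?iterSr//; [exact: smooth_l2|exact: iter_smooth_l2].
Qed.

Definition heat k f : R := dot (iter k smooth f) (iter k smooth f).

Lemma heat_ge0 k f : l2 f -> 0 <= heat k f.
Proof. by move=> lf; apply: dot_ge0; exact: iter_smooth_l2. Qed.

Lemma heat_nonincreasing f : l2 f -> {homo heat^~ f : m n / (m <= n)%N >-> n <= m}.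
Proof.
move=> lf; apply: homo_leq => [x //|y x z yx zy|k]; first exact: le_trans yx.
by rewrite /heat iterS; apply: smooth_contr; exact: iter_smooth_l2.
Qed.

Lemma heat_le k f : l2 f -> heat k f <= dot f f.
Proof. by move=> lf; exact: (heat_nonincreasing lf (leq0n k)). Qed.

Lemma heat_cvg f : l2 f -> cvgn (heat^~ f).
Proof.
move=> lf; apply: nonincreasing_is_cvgn; first exact: heat_nonincreasing.
by exists 0 => _ [k _ <-]; exact: heat_ge0.
Qed.

(* By polarisation, a coefficient is a difference of two monotone bounded sequences. *)
Lemma iter_double_cvg f s : l2 f -> cvgn (fun k => iter k.*2 smooth f s).
Proof.
move=> lf; have ls := l2_basis R s.
have -> : (fun k => iter k.*2 smooth f s) = (fun k =>
    4^-1 * (heat k (f + basis_chain R s) - heat k (f + (-1) *: basis_chain R s))).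
  apply/funext => k; have lfk := iter_smooth_l2 k lf; have lsk := iter_smooth_l2 k ls.
  have lmk := l2Z (-1) lsk.
  rewrite -(dot_basisr s (iter_smooth_l2 _ lf)) -addnn iterD iter_smooth_sym//.
  rewrite /heat !iter_smoothD iter_smoothZ.
  have lD := l2D lfk lsk; have lD' := l2D lfk lmk.
  rewrite (dotDl lfk)// (dotDl lfk)// !(dotDr lfk)//.
  rewrite !(dotZl _ lsk)// !(dotZr _ lsk)// (dotC (iter k smooth (basis_chain R s))).
  by field.
by apply: is_cvgM; [exact: is_cvg_cst|apply: is_cvgB; apply: heat_cvg];
  apply: l2D => //; exact: l2Z.
Qed.

(** The pointwise limit [h] of the even iterates is fixed by S^2, because S acts through finite
    rows. A fixed point of S^2 loses no norm under S, hence has zero energy. Harmonic chains are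
    fixed by the symmetric S, so pairing with them is constant along the iteration, which gives
    orthogonality. *)
Lemma harmonic_limit f : l2 f -> exists h, [/\ l2 h, hodge h = 0,
  forall s, iter k.*2 smooth f s @[k --> \oo] --> h s,
  forall w, l2 w -> hodge w = 0 -> dot (f - h) w = 0 &
  heat k f @[k --> \oo] --> dot h f].
Proof.
move=> lf; pose u k := iter k.*2 smooth f.
pose h : chain R := fun s => limn (fun k => u k s).
have uh s : u k s @[k --> \oo] --> h s by exact: iter_double_cvg.
have lu k : l2 (u k) by exact: iter_smooth_l2.
have uM k : dot (u k) (u k) <= dot f f by exact: (heat_le k.*2).
have [lh hM] := l2_pointwise_lim lu uM uh.
have ssh : smooth (smooth h) = h.
  apply/funext => s.
  have cv : u k.+1 s @[k --> \oo] --> smooth (smooth h) s.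
    by apply: smooth_cvg => t; exact: smooth_cvg.
  have cv' : u k.+1 s @[k --> \oo] --> h s by rewrite (cvg_shiftS (u^~ s)).
  by rewrite -(cvg_lim _ cv)// (cvg_lim _ cv').
(* The norm of [h], being that of S (S h), is at most the norm of S h; the energy term in
   [sqr_smooth_le] must therefore vanish, and L^2 <= C L turns this into L h = 0. *)
have Lh : hodge h = 0.
  have lsh := smooth_l2 lh; have lLh := hodge_l2 lh.
  have h1 := sqr_smooth_le lh; have := smooth_contr lsh; rewrite ssh => h2.
  have h3 : dot (hodge h) h <= 0.
    have : C^-1 * dot (hodge h) h <= 0 by lra.
    by rewrite pmulr_rle0 ?invr_gt0.
  have h4 : dot (hodge h) (hodge h) <= 0.
    by apply: le_trans (sqr_hodge_le lh) _; rewrite pmulr_rle0.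
  apply/funext => s; apply/eqP; rewrite -sqrf_eq0 eq_le sqr_ge0 andbT.
  apply: le_trans h4; apply: le_trans (le_sum_sqr_dot [fset s]%fset lLh).
  by rewrite big_seq_fset1.
exists h; split=> //.
- move=> w lw Lw; rewrite dotBl//.
  have sw : smooth w = w by rewrite /smooth Lw scaler0 subr0.
  have cv := l2_weak_cvg lu uM uh lw.
  have -> : dot h w = dot f w.
    rewrite -(cvg_lim _ cv)//; apply: lim_near_cst => //; apply: nearW => k.
    rewrite /u iter_smooth_sym//; congr dot.
    by elim: k.*2 => // j IH; rewrite iterSr sw.
  by rewrite subrr.
- have -> : (fun k => heat k f) = (fun k => dot (u k) f).
    apply/funext => k; rewrite /heat /u -addnn iterD.
    by rewrite [RHS]iter_smooth_sym//; exact: iter_smooth_l2.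
  exact: l2_weak_cvg lu uM uh lf.
Qed.

End hodge_limit.

(** * Boundary operators of complexes of bounded degree *)

Section incidence_numbers.
Variable R : realType.
Local Open Scope ring_scope.
Implicit Types (s t : {fset nat}) (v w : nat).

Lemma fsetD1_inj s v w : v \in s -> w \in s -> (s `\ v)%fset = (s `\ w)%fset ->
  v = w.
Proof.
move=> vs ws /fsetP/(_ v); rewrite !inE eqxx vs andbT /=.
by have [|] := eqVneq v w.
Qed.

Lemma incidence_face s v : v \in s ->
  incidence R s (s `\ v)%fset = (-1) ^+ #|` [fset w in s | (w < v)%N]%fset|.
Proof.
move=> vs; rewrite /incidence big_mkcond (big_fsetD1 v)//= eqxx.
rewrite big1_fset ?addr0// => w; rewrite !inE => /andP[/eqP wv ws] _.
by case: eqP => // /(fsetD1_inj ws vs).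
Qed.

Lemma incidence_neq0 s t : incidence R s t != 0 ->
  exists2 v, v \in s & t = (s `\ v)%fset.
Proof.
move=> st0; apply: contrapT => nv; move: st0.
rewrite /incidence big_seq_cond big1 ?eqxx// => v /andP[vs /eqP tv].
by exfalso; apply: nv; exists v.
Qed.

Lemma incidence_le1 s t : `|incidence R s t| <= 1.
Proof.
have [->|/incidence_neq0[v vs ->]] := eqVneq (incidence R s t) 0.
  by rewrite normr0.
by rewrite incidence_face// normrX normrN1 expr1n.
Qed.

End incidence_numbers.

(** A covering set instead of a cardinal: it passes to subcomplexes and to images under maps without
    any finiteness side condition. *)
Definition deg_le (d : nat) (K : complex) (v : nat) : Prop :=
  exists2 N : {fset nat}, (#|` N| <= d)%N & forall u, adj K v u -> u \in N.

Section boundary_kernel.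
Variables (R : realType) (K : complex).
Local Open Scope ring_scope.
Local Notation I := {fset nat}.
Implicit Types (s t : I) (f g h w : chain R) (p : nat).

(** The matrix of [bd], with the face as row index. It is extended by zero to all finite sets, so
    that chains of every degree live in one space. *)
Definition bdk p : I -> I -> R := fun t s =>
  if p is 0 then 0 else if `[< simp K p s >] then incidence R s t else 0.

Lemma bdk_neq0 p t s : bdk p t s != 0 ->
  [/\ (0 < p)%N, simp K p s & exists2 v, v \in s & t = (s `\ v)%fset].
Proof.
case: p => [|p] /=; first by rewrite eqxx.
by case: asboolP => [Ks /incidence_neq0|_]; rewrite ?eqxx.
Qed.

Lemma bdk_simp p t s : bdk p.+1 t s != 0 -> simp K p t /\ simp K p.+1 s.
Proof.
move=> /bdk_neq0[_ Ks [v vs ->]]; split => //.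
have [Ks' sp] := Ks; split; last first.
  by move: sp; rewrite (cardfsD1 v) vs => -[].
apply: (simplex_face Ks'); first exact: fsubsetDl.
by rewrite -cardfs_gt0; move: sp; rewrite (cardfsD1 v) vs add1n => -[->].
Qed.

Lemma bdE p f : bd K p f = kapp (bdk p) f.
Proof.
apply/funext => t; rewrite /bd /kapp; case: p => [|p].
  by rewrite fsbig1// => s _; rewrite mul0r.
rewrite fsbig_mkcond; apply: eq_fsbigr => s _; rewrite /patch /bdk.
have [/set_mem Ks|Ks] := boolP (s \in simp K p.+1).
  by rewrite ifT//; exact/asboolP.
by rewrite ifF ?mul0r//; apply/asboolP => /mem_set; exact/negP.
Qed.

Variable d : nat.
Hypothesis Kd : forall v, verts K v -> deg_le d K v.

Lemma simplex_vert s v : K s -> v \in s -> verts K v.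
Proof.
move=> Ks vs; apply: (simplex_face Ks); first by rewrite fsub1set.
by apply/fset0Pn; exists v; rewrite inE.
Qed.

Lemma simplex_adj s u v : K s -> u \in s -> v \in s -> u != v -> adj K u v.
Proof.
move=> Ks us vs uv; split=> //; apply: (simplex_face Ks).
  by apply/fsubsetP => w; rewrite !inE => /orP[] /eqP ->.
by apply/fset0Pn; exists u; rewrite !inE eqxx.
Qed.

(** A simplex containing [v] consists of [v] and neighbours of [v], so it is a subset of a set of at
    most [d.+1] vertices. This is the origin of the constant [2 ^ d.+1] used throughout. *)
Lemma star_bound v : exists2 F : {fset I}, (#|` F| <= 2 ^ d.+1)%N &
  forall s, K s -> v \in s -> s \in F.
Proof.
have [Kv|Kv] := pselect (verts K v); last first.
  by exists fset0 => [|s Ks /(simplex_vert Ks)//]; rewrite cardfs0.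
have [N Nd NP] := Kd Kv; exists (fpowerset (v |` N)%fset).
  rewrite card_fpowerset leq_exp2l// cardfsU1 -add1n.
  by apply: leq_add => //; case: (_ \notin _).
move=> s Ks vs; rewrite fpowersetE; apply/fsubsetP => u us; rewrite !inE.
have [//|uv] := eqVneq u v; apply: NP; apply: (simplex_adj Ks) => //.
by rewrite eq_sym.
Qed.

(** One vertex controls both directions: the cofaces of [t] all contain a chosen vertex of [t], and
    the faces of [s] are subsets of a vertex of [s] together with its neighbours. *)
Lemma bdk_bker p : bker (2 ^ d.+1) (bdk p).
Proof.
split.
- move=> t s; rewrite /bdk; case: p => [|p]; first by rewrite normr0.
  by case: ifP => _; rewrite ?normr0//; exact: incidence_le1.
- move=> t; case: p => [|p].
    by exists fset0 => [|s]; rewrite ?cardfs0//= eqxx.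
  have [t0|/fset0Pn[v vt]] := eqVneq t fset0.
    exists fset0 => [|s]; first by rewrite cardfs0.
    by move=> /bdk_simp[[/simplex_neq0]]; rewrite t0 eqxx.
  have [F Fd FP] := star_bound v; exists F => // s /bdk_neq0[_ [Ks _] [w ws ts]].
  by apply: FP => //; move: vt; rewrite ts !inE => /andP[].
- move=> s; case: p => [|p].
    by exists fset0 => [|t]; rewrite ?cardfs0//= eqxx.
  have [Ks|Ks] := pselect (K s); last first.
    by exists fset0 => [|t /bdk_neq0[_ []//]]; rewrite cardfs0.
  have /fset0Pn[v vs] := simplex_neq0 Ks; have [N Nd NP] := Kd (simplex_vert Ks vs).
  exists (fpowerset (v |` N)%fset).
    rewrite card_fpowerset leq_exp2l// cardfsU1 -add1n.
    by apply: leq_add => //; case: (_ \notin _).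
  move=> t /bdk_neq0[_ _ [w ws ->]]; rewrite fpowersetE.
  apply/fsubsetP => u; rewrite !inE => /andP[_ us].
  have [//|uv] := eqVneq u v; apply: NP; apply: (simplex_adj Ks) => //.
  by rewrite eq_sym.
Qed.

Lemma kapp_trk_supp p g s : ~ simp K p s -> kapp (trk (bdk p)) g s = 0.
Proof.
move=> Ks; rewrite /kapp fsbig1// => t _; rewrite /trk /bdk.
by case: p Ks => [|p] Ks; rewrite ?mul0r//; case: asboolP => //; rewrite mul0r.
Qed.

Lemma kapp_bdk_supp p f t : ~ simp K p t -> kapp (bdk p.+1) f t = 0.
Proof.
move=> Kt; rewrite /kapp fsbig1// => s _; apply/eqP; rewrite mulf_eq0.
by have [//|/bdk_simp[]] := eqVneq (bdk p.+1 t s) 0.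
Qed.

(** The transposed kernel is a candidate for [xget], and testing against basis chains shows that it
    is the only one. *)
Lemma bd_adjE p g : l2 g -> bd_adj K p g = kapp (trk (bdk p)) g.
Proof.
move=> lg; have bT := bker_tr (bdk_bker p).
have lh := kapp_l2 bT lg.
have h0 : l2chain K p (kapp (trk (bdk p)) g) /\ forall f, l2chain K p f ->
    dot (bd K p f) g = dot f (kapp (trk (bdk p)) g).
  split; first by split => // s; exact: kapp_trk_supp.
  by move=> f [_ lf]; rewrite bdE (kapp_adjoint (bdk_bker p)).
rewrite /bd_adj /adjoint; case: xgetP => [h _ [[hs lh'] hP]|/(_ _ h0)//].
apply/funext => s; have [Ks|Ks] := pselect (simp K p s); last first.
  by rewrite hs// kapp_trk_supp.
have ls : l2chain K p (basis_chain R s).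
  split; last exact: l2_basis.
  by move=> t Kt; rewrite /basis_chain; case: eqP Kt => // ->.
by rewrite -(dot_basisl s lh') -hP// h0.2// dot_basisl.
Qed.

Lemma laplacianE p f : l2 f ->
  laplacian K p f = hodge (bdk p) (bdk p.+1) f.
Proof.
move=> lf; rewrite /laplacian (bdE p f) (bd_adjE _ (kapp_l2 (bdk_bker p) lf)).
by rewrite (bd_adjE _ lf) bdE.
Qed.

Lemma hodge_supp p f s : ~ simp K p s -> hodge (bdk p) (bdk p.+1) f s = 0.
Proof.
move=> Ks.
by rewrite -[LHS]/(kapp _ _ s + kapp _ _ s) kapp_trk_supp// kapp_bdk_supp// addr0.
Qed.

Lemma iter_smooth_supp p k f : (forall s, ~ simp K p s -> f s = 0) ->
  forall s, ~ simp K p s -> iter k (smooth (2 ^ d.+1) (bdk p) (bdk p.+1)) f s = 0.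
Proof.
move=> fK s Ks; elim: k => [|k IH]; first exact: fK.
rewrite iterS /smooth; set g := iter _ _ _ in IH *.
by rewrite -[LHS]/(g s - _ * _) IH hodge_supp// mulr0 subr0.
Qed.

Lemma heat_cvg_harmonic p s : simp K p s ->
  heat (2 ^ d.+1) (bdk p) (bdk p.+1) k (basis_chain R s) @[k --> \oo] -->
  dot (orth_proj (harmonic_chain K p) (basis_chain R s)) (basis_chain R s).
Proof.
move=> Ks; have ls := l2_basis R s.
have c0 : (0 < 2 ^ d.+1)%N by rewrite expn_gt0.
have [h [lh Lh uh hw hcv]] := harmonic_limit c0 (bdk_bker p) (bdk_bker p.+1) ls.
have Wh : harmonic_chain K p h.
  split; last by rewrite laplacianE.
  split=> // t Kt; rewrite -(cvg_lim _ (uh t))//.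
  apply: lim_near_cst => //; apply: nearW => k; apply: iter_smooth_supp => // u Ku.
  by rewrite /basis_chain; case: eqP Ku => // ->.
have hP : harmonic_chain K p h /\ forall w, harmonic_chain K p w ->
    dot (basis_chain R s - h) w = 0.
  split=> // w [[_ lw]]; rewrite laplacianE//; exact: hw.
rewrite /orth_proj; case: xgetP => [g _ [Wg gP]|/(_ _ hP)//].
have [[_ lg] _] := Wg.
(* The selected projection [g] and the heat limit [h] are each tested against the other: both
   coefficients equal [dot g h]. *)
suff -> : dot g (basis_chain R s) = dot h (basis_chain R s) by [].
have := gP _ Wh; have := hP.2 _ Wg; rewrite !dotBl// => /subr0_eq e1 /subr0_eq e2.
by rewrite dotC e1 [RHS]dotC e2 dotC.
Qed.

End boundary_kernel.

(** * Locality and isomorphism invariance *)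

Section orientation_change.
Variables (R : realType) (f : nat -> nat).
Local Open Scope ring_scope.
Implicit Types (s t D : {fset nat}) (u v w : nat).

Definition inversions s : nat :=
  (\sum_(v <- s) \sum_(w <- s) ((w < v) && (f v < f w)))%N.

(* The sign of the reordering of the vertices of [s] caused by [f]; it absorbs the
   choice of orientation by the order of [nat]. *)
Definition orient s : R := (-1) ^+ inversions s.

Lemma orient_sqr s : orient s * orient s = 1.
Proof. by rewrite /orient -exprD -signr_odd oddD addbb. Qed.

Lemma card_fset_lt s v : #|` [fset w in s | (w < v)%N]%fset| =
  (\sum_(w <- s) (w < v))%N.
Proof.
rewrite -[RHS]big_mkcond /= sum1_count -size_filter.
rewrite [RHS](_ : _ = #|` [fset w in s | (w < v)%N]%fset|)//.
apply: perm_size; apply: uniq_perm; rewrite ?filter_uniq ?fset_uniq//.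
by move=> w; rewrite mem_filter !inE andbC.
Qed.

Lemma inversionsD1 s v : v \in s -> inversions s =
  (inversions (s `\ v)%fset +
   \sum_(w <- (s `\ v)%fset) (((w < v) && (f v < f w)) + ((v < w) && (f w < f v))))%N.
Proof.
move=> vs; rewrite /inversions (big_fsetD1 v)//= (big_fsetD1 v vs)/= ltnn add0n.
rewrite [X in (_ + X)%N](eq_bigr (fun u => ((v < u) && (f u < f v)) +
  \sum_(w <- (s `\ v)%fset) ((w < u) && (f u < f w)))%N); last first.
  by move=> u _; rewrite (big_fsetD1 v vs).
by rewrite !big_split /= [RHS]addnC addnA.
Qed.

Lemma imfset_fsetD1 s v : {in s &, injective f} -> v \in s ->
  (f @` (s `\ v))%fset = ((f @` s) `\ f v)%fset.
Proof.
move=> fi vs; apply/fsetP => w; rewrite !inE; apply/imfsetP/andP => /=.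
  move=> [u + ->]; rewrite !inE => /andP[uv us]; split; last by apply/imfsetP; exists u.
  by apply: contra_neq uv; apply: fi.
move=> [wv /imfsetP[u /= us wE]]; exists u => //; rewrite !inE us andbT.
by apply: contra_neq wv => <-.
Qed.

(** Modulo 2 the inversions avoiding [v] cancel. For any other vertex [w], the truth values of
    [w < v] and [f w < f v] differ exactly when the pair is inverted. *)
Lemma incidence_imfset_face s v : {in s &, injective f} -> v \in s ->
  incidence R (f @` s)%fset (f @` (s `\ v))%fset =
  orient s * orient (s `\ v)%fset * incidence R s (s `\ v)%fset.
Proof.
move=> fi vs; rewrite imfset_fsetD1// !incidence_face//; last first.
  by apply/imfsetP; exists v.
rewrite /orient -!exprD -signr_odd -[RHS]signr_odd; congr (_ ^+ (nat_of_bool _)).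
rewrite !card_fset_lt big_imfset//= (inversionsD1 vs).
rewrite [X in _ = odd (X + _)%N]addnAC addnn -addnA oddD odd_double /=.
rewrite !(big_fsetD1 v vs)/= !ltnn !add0n -big_split /=.
rewrite !(big_morph odd oddD (erefl _)).
apply: eq_big_seq => w; rewrite !inE => /andP[wv ws].
have fwv : f w != f v by apply: contra_neq wv; apply: fi.
by case: (ltngtP w v) wv => // _ _; case: (ltngtP (f w) (f v)) fwv.
Qed.

Lemma imfset_inj_sub D s t : {in D &, injective f} -> (s `<=` D)%fset ->
  (t `<=` D)%fset -> (f @` s)%fset = (f @` t)%fset -> s = t.
Proof.
move=> fi.
have H a b : (a `<=` D)%fset -> (b `<=` D)%fset -> (f @` a)%fset = (f @` b)%fset ->
    (a `<=` b)%fset.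
  move=> /fsubsetP aD /fsubsetP bD ab; apply/fsubsetP => v va.
  have : f v \in (f @` b)%fset by rewrite -ab; apply/imfsetP; exists v.
  by move=> /imfsetP[w /= wb /fi ->//]; [exact: aD|exact: bD].
move=> sD tD st; apply/eqP.
by rewrite eqEfsubset (H _ _ sD tD st) (H _ _ tD sD (esym st)).
Qed.

Lemma incidence_imfset D s t : {in D &, injective f} -> (s `<=` D)%fset ->
  (t `<=` D)%fset ->
  incidence R (f @` s)%fset (f @` t)%fset = orient s * orient t * incidence R s t.
Proof.
move=> fi sD tD; have fs : {in s &, injective f}.
  by move=> u v /(fsubsetP sD) uD /(fsubsetP sD); exact: fi.
have [[v vs ->]|nst] := pselect (exists2 v, v \in s & t = (s `\ v)%fset).
  exact: incidence_imfset_face.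
have -> : incidence R s t = 0.
  by apply/eqP; apply: contra_notT nst => /incidence_neq0.
rewrite mulr0; apply/eqP; apply: contra_notT nst => /incidence_neq0[w].
move=> /imfsetP[v /= vs ->]; rewrite -imfset_fsetD1// => ft.
exists v => //; apply: (imfset_inj_sub fi tD _ ft).
exact: fsubset_trans (fsubsetDl _ _) sD.
Qed.

End orientation_change.

(** * Transport of the heat along an isomorphism of balls *)

Section local_isomorphism.
Variables (R : realType) (f : nat -> nat) (M N : complex).
(** The sets [DM j] and [DN j] play the role of balls of radius [j]. They are abstract because [M]
    and [N] will be truncated complexes, while the balls are those of the original ones. *)
Variables (DM DN : nat -> {fset nat}) (r : nat).
Local Open Scope ring_scope.
Implicit Types (s t : {fset nat}) (h : chain R) (j k p : nat).

Hypothesis finj : {in DM r &, injective f}.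
Hypothesis fD : forall j, (j <= r)%N -> (f @` DM j)%fset = DN j.
Hypothesis fM : forall s, (s `<=` DM r)%fset -> M s <-> N (f @` s)%fset.
Hypothesis DMS : forall j, (DM j `<=` DM j.+1)%fset.
Hypothesis DNS : forall j, (DN j `<=` DN j.+1)%fset.
Hypothesis starM : forall j s v, M s -> v \in s -> v \in DM j -> (s `<=` DM j.+1)%fset.
Hypothesis starN : forall j s v, N s -> v \in s -> v \in DN j -> (s `<=` DN j.+1)%fset.

Let DM_le i j : (i <= j)%N -> (DM i `<=` DM j)%fset.
Proof.
elim: j => [|j IH]; first by rewrite leqn0 => /eqP ->.
rewrite leq_eqVlt => /orP[/eqP ->//|/IH ij]; exact: fsubset_trans ij (DMS j).
Qed.

Let imfsetS j s : (j <= r)%N -> (s `<=` DM j)%fset -> (f @` s `<=` DN j)%fset.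
Proof.
move=> jr /fsubsetP sD; rewrite -fD//; apply/fsubsetP => _ /imfsetP[v /= /sD vD ->].
by apply/imfsetP; exists v.
Qed.

Let imfset_onto j t : (j <= r)%N -> (t `<=` DN j)%fset ->
  exists2 s, (s `<=` DM j)%fset & t = (f @` s)%fset.
Proof.
move=> jr /fsubsetP tD; exists [fset v in DM j | f v \in t]%fset.
  by apply/fsubsetP => v; rewrite !inE => /andP[].
apply/fsetP => w; apply/idP/imfsetP => [wt|[v /=]]; last by rewrite !inE => /andP[_ ? ->].
have := tD _ wt; rewrite -fD// => /imfsetP[v /= vD wE].
by exists v => //; rewrite !inE vD -wE wt.
Qed.

Let simp_imfset p s : (s `<=` DM r)%fset -> simp M p s <-> simp N p (f @` s)%fset.
Proof.
move=> sD; rewrite /simp /= (fM sD) card_in_imfset//.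
by move=> u v /(fsubsetP sD) uD /(fsubsetP sD); exact: finj.
Qed.

Let bdk_imfset p s t : (s `<=` DM r)%fset -> (t `<=` DM r)%fset ->
  bdk R N p (f @` s)%fset (f @` t)%fset = orient R f s * orient R f t * bdk R M p s t.
Proof.
move=> sD tD; rewrite /bdk; case: p => [|p]; first by rewrite mulr0.
rewrite -(asbool_equiv_eq (simp_imfset p.+1 tD)).
case: asboolP => _; last by rewrite mulr0.
by rewrite (incidence_imfset _ finj tD sD) [X in X * _]mulrC.
Qed.

Let near (D : nat -> {fset nat}) (B : {fset nat} -> {fset nat} -> R) :=
  forall j s t, B s t != 0 -> (t `<=` D j)%fset -> (s `<=` D j.+1)%fset.

(** Passing to a face never leaves the ball; a coface shares a vertex with the given simplex, so it
    lies in the star of the ball. *)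
Let bdk_near (K : complex) (D : nat -> {fset nat}) p :
  (forall j, (D j `<=` D j.+1)%fset) ->
  (forall j s v, K s -> v \in s -> v \in D j -> (s `<=` D j.+1)%fset) ->
  near D (bdk R K p) /\ near D (trk (bdk R K p)).
Proof.
move=> DS st; split=> j s t.
  move=> /bdk_neq0[_ _ [v _ ->]] tD.
  exact: fsubset_trans (fsubset_trans (fsubsetDl _ _) tD) (DS j).
case: p => [|p]; first by rewrite /trk /= eqxx.
move=> B0 /fsubsetP tD; have [[/simplex_neq0/fset0Pn[v vt] _] [Ks _]] := bdk_simp B0.
have [_ _ [w ws tE]] := bdk_neq0 B0.
apply: (st j s v Ks); last exact: tD.
by move: vt; rewrite tE !inE => /andP[].
Qed.

(* [h] on [M] and [h'] on [N] correspond under [f] and are supported in the balls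
   of radius [j]; a boundary or coboundary operator costs one unit of radius. *)
Definition transported j h h' :=
  [/\ forall s, h s != 0 -> (s `<=` DM j)%fset,
      forall s, h' s != 0 -> (s `<=` DN j)%fset &
      forall s, (s `<=` DM r)%fset -> h' (f @` s)%fset = orient R f s * h s].

Let transported_sum j (a b : {fset nat} -> R) : (j <= r)%N ->
  (forall s, (s `<=` DM j)%fset -> b (f @` s)%fset = a s) ->
  \sum_(t <- fpowerset (DN j)) b t = \sum_(s <- fpowerset (DM j)) a s.
Proof.
move=> jr ab.
have -> : fpowerset (DN j) = ((fun s : {fset nat} => f @` s) @` fpowerset (DM j))%fset.
  apply/fsetP => t; rewrite fpowersetE; apply/idP/imfsetP => /=.
    by move=> /(imfset_onto jr)[s sD ->]; exists s; rewrite ?fpowersetE.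
  by move=> [s]; rewrite fpowersetE => sD ->; exact: imfsetS.
rewrite big_imfset/=; last first.
  move=> s t; rewrite !fpowersetE => sD tD; apply: (imfset_inj_sub finj).
    exact: fsubset_trans sD (DM_le jr).
  exact: fsubset_trans tD (DM_le jr).
by apply: eq_big_seq => s; rewrite fpowersetE; exact: ab.
Qed.

Lemma transported_dot j h h' : (j <= r)%N -> transported j h h' ->
  dot h' h' = dot h h.
Proof.
move=> jr [hD hD' hh'].
have H (g : chain R) (D : {fset nat}) : (forall s, g s != 0 -> (s `<=` D)%fset) ->
    dot g g = \sum_(s <- fpowerset D) g s * g s.
  move=> gD; have g0 s : s \notin fpowerset D -> g s = 0.
    by rewrite fpowersetE => sD; apply/eqP; apply: contraNT sD => /gD.
  by apply: dot_fin => //; exact: l2_fin g0.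
rewrite (H _ _ hD) (H _ _ hD'); apply: transported_sum => // s sD.
rewrite (hh' _ (fsubset_trans sD (DM_le jr))) mulrACA orient_sqr.
by rewrite mul1r.
Qed.

Let kapp_fpowerset (B : {fset nat} -> {fset nat} -> R) h (D : {fset nat}) s :
  (forall t, h t != 0 -> (t `<=` D)%fset) ->
  kapp B h s = \sum_(t <- fpowerset D) B s t * h t.
Proof.
move=> hD; apply: kapp_supp => t; rewrite mulf_eq0 negb_or fpowersetE.
by move=> /andP[_ /hD].
Qed.

Let kapp_neq0 (B : {fset nat} -> {fset nat} -> R) h s : kapp B h s != 0 ->
  exists2 t, B s t != 0 & h t != 0.
Proof.
move=> B0; apply: contrapT => nt; move: B0; rewrite /kapp fsbig1 ?eqxx// => t _.
apply/eqP; apply: contra_notT nt; rewrite mulf_eq0 negb_or => /andP[? ?].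
by exists t.
Qed.

Let transported_kapp (B B' : {fset nat} -> {fset nat} -> R) j h h' : (j <= r)%N ->
  near DM B -> near DN B' ->
  (forall s t, (s `<=` DM r)%fset -> (t `<=` DM r)%fset ->
    B' (f @` s)%fset (f @` t)%fset = orient R f s * orient R f t * B s t) ->
  transported j h h' -> transported j.+1 (kapp B h) (kapp B' h').
Proof.
move=> jr nB nB' BB' [hD hD' hh']; split.
- by move=> s /kapp_neq0[t Bst /hD]; exact: nB.
- by move=> s /kapp_neq0[t Bst /hD']; exact: nB'.
- move=> s sD; rewrite (kapp_fpowerset _ _ hD) (kapp_fpowerset _ _ hD') mulr_sumr.
  apply: transported_sum => // t tD.
  have tr : (t `<=` DM r)%fset by exact: fsubset_trans tD (DM_le jr).
  rewrite BB'// hh'// -[in RHS](mul1r (_ * h t)) -(orient_sqr R f t).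
  by ring.
Qed.

Let transportedS j h h' : transported j h h' -> transported j.+1 h h'.
Proof.
move=> [hD hD' hh']; split=> // s.
  by move=> /hD sD; exact: fsubset_trans (DMS j).
by move=> /hD' sD; exact: fsubset_trans (DNS j).
Qed.

Let transportedD j g g' h h' : transported j g g' -> transported j h h' ->
  transported j (g + h) (g' + h').
Proof.
move=> [gD gD' gg'] [hD hD' hh']; split=> s.
- rewrite -[(g + h) s]/(g s + h s) => gh0.
  have [g0|/gD//] := eqVneq (g s) 0; apply: hD.
  by move: gh0; rewrite g0 add0r.
- rewrite -[(g' + h') s]/(g' s + h' s) => gh0.
  have [g0|/gD'//] := eqVneq (g' s) 0; apply: hD'.
  by move: gh0; rewrite g0 add0r.
- by move=> sD; rewrite -[LHS]/(g' _ + h' _) gg'// hh'// -mulrDr.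
Qed.

Let transportedZ j a h h' : transported j h h' -> transported j (a *: h) (a *: h').
Proof.
move=> [hD hD' hh']; split=> s.
- by rewrite -[(a *: h) s]/(a * h s) mulf_eq0 negb_or => /andP[_ /hD].
- by rewrite -[(a *: h') s]/(a * h' s) mulf_eq0 negb_or => /andP[_ /hD'].
- by move=> sD; rewrite -[LHS]/(a * h' _) hh'// mulrCA.
Qed.

Let transported_smooth c p j h h' : (j.+2 <= r)%N -> transported j h h' ->
  transported j.+2 (smooth c (bdk R M p) (bdk R M p.+1) h)
                   (smooth c (bdk R N p) (bdk R N p.+1) h').
Proof.
move=> jr tr; rewrite /smooth -!scaleNr.
have jr1 := ltnW jr; have jr0 := ltnW jr1.
have K q : transported j.+2 (kapp (trk (bdk R M q)) (kapp (bdk R M q) h))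
                            (kapp (trk (bdk R N q)) (kapp (bdk R N q) h')).
  have [nM nM'] := bdk_near q DMS starM; have [nN nN'] := bdk_near q DNS starN.
  apply: transported_kapp => //.
    by move=> s t sD tD; rewrite /trk bdk_imfset// [X in X * _]mulrC.
  by apply: transported_kapp => // s t sD tD; rewrite bdk_imfset.
have K' q : transported j.+2 (kapp (bdk R M q) (kapp (trk (bdk R M q)) h))
                             (kapp (bdk R N q) (kapp (trk (bdk R N q)) h')).
  have [nM nM'] := bdk_near q DMS starM; have [nN nN'] := bdk_near q DNS starN.
  apply: transported_kapp => //; first by move=> s t sD tD; rewrite bdk_imfset.
  apply: transported_kapp => // s t sD tD.
  by rewrite /trk bdk_imfset// [X in X * _]mulrC.
apply: transportedD; first by do 2 apply: transportedS.
by apply: transportedZ; exact: transportedD.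
Qed.

Let transported_iter c p j k h h' : (j + k.*2 <= r)%N -> transported j h h' ->
  transported (j + k.*2) (iter k (smooth c (bdk R M p) (bdk R M p.+1)) h)
                         (iter k (smooth c (bdk R N p) (bdk R N p.+1)) h').
Proof.
elim: k => [|k IH] jk tr; first by rewrite addn0.
rewrite !iterS doubleS !addnS; apply: transported_smooth.
  by move: jk; rewrite doubleS !addnS.
by apply: IH => //; apply: leq_trans jk; rewrite leq_add2l leq_double.
Qed.

Lemma heat_imfset c p j k s : (j + k.*2 <= r)%N -> (s `<=` DM j)%fset ->
  bker c (bdk R N p) -> bker c (bdk R N p.+1) ->
  heat c (bdk R N p) (bdk R N p.+1) k (basis_chain R (f @` s)%fset) =
  heat c (bdk R M p) (bdk R M p.+1) k (basis_chain R s).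
Proof.
move=> jk sj b0 b1; have jr : (j <= r)%N by exact: leq_trans (leq_addr _ _) jk.
have sr := fsubset_trans sj (DM_le jr).
(* Basis chains correspond only up to the orientation sign, which disappears because [heat] is
   quadratic. *)
have tr : transported j (basis_chain R s) (orient R f s *: basis_chain R (f @` s)%fset).
  split=> t.
  - by rewrite /basis_chain pnatr_eq0 eqb0 negbK => /eqP ->.
  - rewrite -[(_ *: _) t]/(_ * (t == _)%:R) mulf_eq0 negb_or pnatr_eq0 eqb0 negbK.
    by move=> /andP[_ /eqP ->]; exact: imfsetS.
  - move=> tr; rewrite -[LHS]/(_ * (_ == _)%:R) /basis_chain.
    have [->|ts] := eqVneq t s; first by rewrite eqxx.
    rewrite (_ : (_ == _) = false) ?mulr0//; apply/negbTE; apply: contra_neq ts.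
    exact: imfset_inj_sub finj tr sr.
have := transported_dot jk (transported_iter c p jk tr).
have lb := iter_smooth_l2 b0 b1 k (l2_basis R (f @` s)%fset).
rewrite (iter_smoothZ b0 b1) (dotZl _ lb (l2Z _ lb)) (dotZr _ lb lb).
by rewrite mulrA orient_sqr mul1r.
Qed.

End local_isomorphism.

(* A sofic measure of degree at most [d] may be a limit of finite complexes whose
   degrees are not bounded by [d]. Truncating every complex makes all estimates
   uniform, and changes nothing when the degrees are at most [d]. *)
Definition trunc (d : nat) (K : complex) : complex := full_sub K (deg_le d K).

Lemma complex_eq (K L : complex) : simplices K = simplices L -> K = L.
Proof.
case: K L => [S h1 h2] [S' h1' h2'] /= E; subst S'.
by congr Complex; exact: Prop_irrelevance.
Qed.

Section truncation.
Variable d : nat.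
Implicit Types (K L : complex) (x y u v : nat) (f : nat -> nat).

Lemma trunc_deg_le K v : verts (trunc d K) v -> deg_le d (trunc d K) v.
Proof.
move=> /verts_full_sub[_ [N Nd NP]]; exists N => // u [uv [Kuv _]].
by apply: NP.
Qed.

Lemma trunc_id K : (forall v, verts K v -> deg_le d K v) -> trunc d K = K.
Proof.
move=> Kd; have E : simplices (trunc d K) = simplices K.
  apply/funext => s; apply/propext; split=> [[]//|Ks]; split=> // v vs.
  by apply: Kd; apply: simplex_vert Ks vs.
exact: complex_eq.
Qed.

(** The neighbours of a vertex at distance [r] lie at distance at most [r.+1], so reading off a
    degree costs one unit of radius. *)
Lemma deg_le_isom f K x L y r v : verts K x -> verts L y ->
  is_isom f (cball K x r.+1) x (cball L y r.+1) y -> dist_le K r x v ->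
  deg_le d K v -> deg_le d L (f v).
Proof.
move=> Kx Ly fI dv [N Nd NP].
have BKx : verts (cball K x r.+1) x by apply/verts_cball => //; exact: dist_le0.
have [g gI [fg gf]] := is_isom_inv BKx fI.
have dfv : dist_le L r y (f v) by apply: (isom_dist_le Kx Ly fI) => //.
exists (f @` N)%fset.
  by apply: leq_trans Nd; exact: leq_imfset_card.
move=> u' [vu' Lvu'].
have du' : dist_le L r.+1 y u' by exact: dist_leS dfv _.
have Bu' : verts (cball L y r.+1) u' by apply/verts_cball.
have du : dist_le K r.+1 x (g u') by exact: isom_dist_le gI _ _.
have fu : f (g u') = u' by apply: fg; exact/mem_set.
apply/imfsetP; exists (g u') => //=; apply: NP; split.
  by apply: contra_neq vu' => ->.
have dv1 : dist_le K r.+1 x v by exact: dist_le_leq dv.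
case: fI => _ _ fs.
have sB w : w \in [fset v; g u']%fset -> verts (cball K x r.+1) w.
  by rewrite !inE => /orP[] /eqP ->; apply/verts_cball.
have [_ []//] := fs _ sB; rewrite imfset_fset2 fu; split=> // w.
rewrite !inE => /orP[] /eqP -> //; exact: dist_le_leq dfv.
Qed.

End truncation.

(** * The heat density at the root, its monotonicity, limit and locality *)

Section heat_density.
Variables (R : realType) (d p : nat).
Local Open Scope ring_scope.
Implicit Types (K L : complex) (x y u v k : nat) (s : {fset nat}).

Definition simplex_heat k K s : R :=
  heat (2 ^ d.+1) (bdk R (trunc d K) p) (bdk R (trunc d K) p.+1) k (basis_chain R s).

Definition heat_density k K x : R :=
  \sum_(s \in [set s | simp (trunc d K) p s /\ x \in s]) simplex_heat k K s / p.+1%:R.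

Lemma star_finite K x :
  exists2 F : {fset {fset nat}}, (#|` F| <= 2 ^ d.+1)%N &
    [set s | simp (trunc d K) p s /\ x \in s] = [set` F].
Proof.
have [F Fd FP] := star_bound (@trunc_deg_le d K) x.
exists [fset s in F | `[< simp (trunc d K) p s /\ x \in s >]]%fset.
  by apply: leq_trans Fd; apply: fsubset_leq_card; exact: fset_sub.
apply/seteqP; split=> s /=; rewrite !inE; last by move=> /andP[_ /asboolP].
move=> [[Ks sp] xs]; apply/andP; split; first exact: FP.
exact/asboolP.
Qed.

Let bK K q := @bdk_bker R (trunc d K) d (@trunc_deg_le d K) q.

Lemma simplex_heat_ge0 k K s : 0 <= simplex_heat k K s.
Proof. by apply: (heat_ge0 (bK K p)) => //; exact: l2_basis. Qed.

Lemma simplex_heat_noninc K s m n : (m <= n)%N ->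
  simplex_heat n K s <= simplex_heat m K s.
Proof.
move=> mn; apply: (heat_nonincreasing _ (bK K p)) => //; last exact: l2_basis.
by rewrite expn_gt0.
Qed.

Lemma simplex_heat_le1 k K s : simplex_heat k K s <= 1.
Proof.
apply: le_trans (simplex_heat_noninc K s (leq0n k)) _.
by rewrite /simplex_heat /heat /= dot_basisl ?/basis_chain ?eqxx//; exact: l2_basis.
Qed.

Let invp_ge0 : 0 <= p.+1%:R^-1 :> R.
Proof. by rewrite invr_ge0. Qed.

Lemma heat_density_ge0 k K x : 0 <= heat_density k K x.
Proof. by apply: fsumr_ge0 => s _; rewrite mulr_ge0// simplex_heat_ge0. Qed.

Lemma heat_density_noninc K x m n : (m <= n)%N ->
  heat_density n K x <= heat_density m K x.
Proof.
move=> mn; rewrite /heat_density; have [F _ ->] := star_finite K x.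
rewrite -!fsbig_seq//; apply: ler_sum => s _.
by rewrite ler_wpM2r// simplex_heat_noninc.
Qed.

Lemma heat_density_le k K x : heat_density k K x <= (2 ^ d.+1)%:R.
Proof.
rewrite /heat_density; have [F Fd ->] := star_finite K x.
rewrite -!fsbig_seq//.
apply: (@le_trans _ _ (\sum_(s <- F) 1)); last first.
  by rewrite big_const_seq count_predT iter_addr_0 ler_nat.
apply: ler_sum => s _; rewrite ler_pdivrMr ?ltr0Sn// mul1r.
by apply: le_trans (simplex_heat_le1 k K s) _; rewrite ler1n.
Qed.

Lemma heat_density_cvg (K : rcomplex) : (forall v, verts K v -> deg_le d K v) ->
  heat_density k K (rc_root K) @[k --> \oo] --> betti_density R p K.
Proof.
move=> Kd; have tK : trunc d K = K by exact: trunc_id.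
rewrite /heat_density /betti_density /simplex_heat tK.
have [F Fd FE] := star_finite K (rc_root K); rewrite tK in FE.
rewrite FE -fsbig_seq//.
rewrite [X in X @ _](_ : _ = fun k => \sum_(s <- F)
    heat (2 ^ d.+1) (bdk R K p) (bdk R K p.+1) k (basis_chain R s) / p.+1%:R); last first.
  by apply/funext => k; rewrite -fsbig_seq.
have : forall s, s \in (F : seq _) -> simp K p s.
  by move=> s sF; have : [set` F] s by []; rewrite -FE => -[].
elim: (F : seq _) => [|s q IH] qK.
  rewrite big_nil [X in X @ _](_ : _ = fun=> 0); first exact: cvg_cst.
  by apply/funext => k; rewrite big_nil.
rewrite big_cons.
rewrite [X in X @ _](_ : _ = fun k =>
  heat (2 ^ d.+1) (bdk R K p) (bdk R K p.+1) k (basis_chain R s) / p.+1%:R +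
  \sum_(t <- q) heat (2 ^ d.+1) (bdk R K p) (bdk R K p.+1) k (basis_chain R t) / p.+1%:R).
  apply: cvgD; last by apply: IH => t tq; apply: qK; rewrite inE tq orbT.
  apply: cvgMl; apply: heat_cvg_harmonic => //.
  by apply: qK; rewrite inE eqxx.
by apply/funext => k; rewrite big_cons.
Qed.

(** The radius adds up as follows: 1 for the simplices at the root, 2 for each of the [k]
    applications of S, and 1 more to decide which vertices survive the truncation. *)
Lemma isom_heat_density k K x L y : verts K x -> verts L y ->
  locally_finite K -> locally_finite L ->
  isom (cball K x k.*2.+2) x (cball L y k.*2.+2) y ->
  heat_density k K x = heat_density k L y.
Proof.
move=> Kx Ly lfK lfL [f fI].
set r := k.*2.+1 in fI.
have BKx : verts (cball K x r.+1) x by apply/verts_cball => //; exact: dist_le0.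
have [g gI [fg gf]] := is_isom_inv BKx fI.
pose D K x j := fset_set [set v | dist_le K j x v].
have DP (M : complex) z j v : verts M z -> locally_finite M ->
    (v \in D M z j) <-> dist_le M j z v.
  move=> Mz lfM; rewrite /D in_fset_set ?inE//; exact: finite_dist_le.
have DK j v := DP K x j v Kx lfK; have DL j v := DP L y j v Ly lfL.
have fd j v : (j <= r.+1)%N -> dist_le K j x v -> dist_le L j y (f v).
  by exact: isom_dist_le.
have gd j v : (j <= r.+1)%N -> dist_le L j y v -> dist_le K j x (g v).
  by exact: isom_dist_le.
have fgE j v : (j <= r.+1)%N -> dist_le L j y v -> f (g v) = v.
  by move=> jr dv; apply/fg/mem_set/verts_cball => //; exact: dist_le_leq dv.
have gfE j v : (j <= r.+1)%N -> dist_le K j x v -> g (f v) = v.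
  by move=> jr dv; apply/gf/mem_set/verts_cball => //; exact: dist_le_leq dv.
have fj : {in D K x r &, injective f}.
  by move=> u v /DK du /DK dv uv; rewrite -(gfE _ _ _ du)// uv (gfE _ _ _ dv).
have fD j : (j <= r)%N -> (f @` D K x j)%fset = D L y j.
  move=> jr; have jr1 : (j <= r.+1)%N by exact: leqW.
  apply/fsetP => w; apply/imfsetP/idP => /= [[v /DK dv ->]|/DL dw].
    exact/DL/fd.
  by exists (g w); [exact/DK/gd|rewrite (fgE _ _ _ dw)].
have degf v : dist_le K r x v -> deg_le d K v <-> deg_le d L (f v).
  move=> dv; split; first exact: deg_le_isom fI dv.
  have dfv : dist_le L r y (f v) by exact: fd.
  by move=> /(deg_le_isom Ly Kx gI dfv); rewrite (gfE r).
have fM s : (s `<=` D K x r)%fset -> trunc d K s <-> trunc d L (f @` s)%fset.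
  move=> /fsubsetP sD; have sd v : v \in s -> dist_le K r x v by move=> /sD/DK.
  have sB v : v \in s -> verts (cball K x r.+1) v.
    by move=> /sd dv; apply/verts_cball => //; exact: dist_le_leq dv.
  have [_ _ /(_ s sB)[h1 h2]] := fI; split=> -[Ks sdeg].
    split; first by apply: (h1 _).1; split=> // v /sd; exact: dist_le_leq.
    by move=> _ /imfsetP[v /= vs ->]; apply/degf; [exact: sd|exact: sdeg].
  split.
    apply: (h2 _).1; split=> // _ /imfsetP[v /= vs ->].
    by apply: fd => //; apply: dist_le_leq (sd _ vs).
  by move=> v vs; apply/degf; [exact: sd|apply: sdeg; apply/imfsetP; exists v].
have DS (M : complex) z j : verts M z -> locally_finite M ->
    (D M z j `<=` D M z j.+1)%fset.
  move=> Mz lfM; apply/fsubsetP => v /DP-/(_ Mz lfM) dv; apply/DP => //.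
  exact: dist_le_leq dv.
have star (M : complex) z j s v : verts M z -> locally_finite M ->
    trunc d M s -> v \in s -> v \in D M z j -> (s `<=` D M z j.+1)%fset.
  move=> Mz lfM [Ms _] vs /DP-/(_ Mz lfM) dv; apply/fsubsetP => u us; apply/DP => //.
  have [->|uv] := eqVneq u v; first exact: dist_le_leq dv.
  by apply: dist_leS dv _; apply: simplex_adj Ms _ _ _ => //; rewrite eq_sym.
have Dx (M : complex) z : verts M z -> locally_finite M -> z \in D M z 0.
  by move=> Mz lfM; apply/DP => //; exact: dist_le0.
have xs s : trunc d K s -> x \in s -> (s `<=` D K x 1)%fset.
  by move=> Ks xs; exact: star (Dx _ _ Kx lfK).
have DKr s : (s `<=` D K x 1)%fset -> (s `<=` D K x r)%fset.
  move=> /fsubsetP s1; apply/fsubsetP => v /s1/DK dv; apply/DK.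
  exact: dist_le_leq dv.
have fx : f x = y by case: fI.
have card_f s : (s `<=` D K x r)%fset -> #|` (f @` s)%fset| = #|` s|.
  move=> /fsubsetP sD; rewrite card_in_imfset//= => u v us vs; apply: fj; exact: sD.
have fbij : set_bij [set s | simp (trunc d K) p s /\ x \in s]
    [set s | simp (trunc d L) p s /\ y \in s] (fun s : {fset nat} => f @` s)%fset.
  split.
  - move=> s /= [[Ks sp] xis]; have sr := DKr _ (xs _ Ks xis).
    split; last by rewrite -fx; apply/imfsetP; exists x.
    by split; [exact/fM|rewrite card_f].
  - move=> s t /set_mem[[Ks _] xis] /set_mem[[Kt _] xit].
    by apply: (imfset_inj_sub fj); [exact/DKr/xs|exact/DKr/xs].
  - move=> t /= [[Lt tp] yt]; have t1 := star L y 0%N t y Ly lfL Lt yt (Dx _ _ Ly lfL).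
    have tE : t = (f @` (g @` t))%fset.
      apply/fsetP => w; apply/idP/imfsetP => /= [wt|[v /imfsetP[u /= ut ->] ->]].
        exists (g w); first by apply/imfsetP; exists w.
        by rewrite (fgE 1%N)//; apply/DL; exact: (fsubsetP t1).
      by rewrite (fgE 1%N)//; apply/DL; exact: (fsubsetP t1).
    have gt1 : (g @` t `<=` D K x 1)%fset.
      apply/fsubsetP => _ /imfsetP[u /= /(fsubsetP t1)/DL du ->].
      by apply/DK/gd.
    exists (g @` t)%fset => //; split; first split.
    + by apply/fM; [exact: DKr|rewrite -tE].
    + by rewrite -(card_f _ (DKr _ gt1)) -tE.
    + apply/imfsetP; exists y => //=.
      by rewrite -(gfE 0%N x) ?fx//; exact: dist_le0.
rewrite /heat_density.
transitivity (\sum_(s \in [set s | simp (trunc d K) p s /\ x \in s])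
    simplex_heat k L (f @` s)%fset / p.+1%:R); last first.
  by symmetry; exact: reindex_fsbig fbij.
apply: eq_fsbigr => s /set_mem[[Ks _] xis]; congr (_ / _).
symmetry.
apply: (@heat_imfset R f _ _ (D K x) (D L y) r fj fD fM _ _ _ _ _ p 1%N k s) => //.
- by move=> j; exact: DS.
- by move=> j; exact: DS.
- by move=> j t v; exact: star.
- by move=> j t v; exact: star.
- exact: xs.
Qed.

End heat_density.

(** * Integer matrices and the spectral gap at zero *)

Section eigenvalue_gap.
Local Open Scope ring_scope.

(** Subtracting the sum for [j] cancels the zero values, which contribute 1 to both sums; the other
    terms of that sum are nonnegative and are dropped. What remains is split at the threshold
    [b ^+ q]. *)
Lemma small_eigenvalues_gap (F : numFieldType) (n q : nat) (b : F) (y : 'I_n -> F) :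
  0 < b < 1 -> (0 < q)%N -> (forall i, 0 <= y i <= 1) ->
  b ^+ n <= \prod_(i | y i != 0) y i ->
  forall j k, \sum_i (1 - y i) ^+ k - \sum_i (1 - y i) ^+ j <=
    n%:R * (q%:R^-1 + (1 - b ^+ q) ^+ k).
Proof.
move=> /andP[b0 b1] q0 y01 bn j k.
have bq0 : 0 < b ^+ q by rewrite exprn_gt0.
have bq1 : b ^+ q <= 1 by rewrite exprn_ile1// ltW.
have y0 i : 0 <= y i by have /andP[] := y01 i.
have y1 i : y i <= 1 by have /andP[] := y01 i.
pose small i := (y i != 0) && (y i < b ^+ q).
pose m := (\sum_i small i)%N.
(* The product is at most [(b ^+ q) ^+ m], as the values that are not small are at most 1; since
   [b < 1], exponents can be compared. *)
have mn : (q * m <= n)%N.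
  rewrite -(ler_iXn2l b0 b1); apply: (le_trans bn).
  rewrite (bigID small)/= -[leRHS]mulr1 exprM.
  apply: ler_pM.
  - by apply: prodr_ge0.
  - by apply: prodr_ge0.
  - apply: (@le_trans _ _ (\prod_(i | (y i != 0) && small i) b ^+ q)).
      by apply: ler_prod => i /andP[_ /andP[_ /ltW ->]]; rewrite y0.
    rewrite prodr_const /m -sum1_card big_mkcond /=.
    rewrite (_ : (\sum_i _)%N = (\sum_i small i)%N)//.
    apply: eq_bigr => i _; rewrite unfold_in /small.
    by case: (y i != 0) => //=; case: (_ < _).
  - by apply: prodr_ile1 => i _; rewrite y0 y1.
have mq : m%:R <= n%:R * q%:R^-1 :> F.
  by rewrite ler_pdivlMr ?ltr0n// -natrM ler_nat mulnC.
apply: (@le_trans _ _ (\sum_i ((small i)%:R + (1 - b ^+ q) ^+ k))).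
  rewrite -sumrB; apply: ler_sum => i _.
  have z0 : 0 <= 1 - y i by rewrite subr_ge0.
  have w0 : 0 <= 1 - b ^+ q by rewrite subr_ge0.
  rewrite /small; have [yi0|yi0] /= := eqVneq (y i) 0.
    by rewrite yi0 subr0 !expr1n subrr add0r exprn_ge0.
  apply: (@le_trans _ _ ((1 - y i) ^+ k)).
    by rewrite gerBl exprn_ge0.
  have [_|h] := real_ltP (ger0_real (y0 i)) (gtr0_real bq0).
    by rewrite -[leLHS]addr0 lerD ?exprn_ge0// exprn_ile1// gerBl.
  by rewrite add0r lerXn2r ?nnegrE// lerB.
rewrite big_split /= -natr_sum -/m sumr_const card_ord mulrDr lerD//.
by rewrite mulr_natl.
Qed.

End eigenvalue_gap.

(** * Eigenvalues of integer Gram matrices *)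

Section integer_matrix_gap.
Import sesquilinear spectral.
Local Open Scope ring_scope.
Local Open Scope sesquilinear_scope.
Variables (n m l c : nat) (A : 'M[int]_(n, m)) (E : 'M[int]_(l, n)).

Definition gram : 'M[int]_n := A *m A^T + E^T *m E.

Hypothesis rowA : forall i, \sum_u `|A i u| <= c%:Z.
Hypothesis colA : forall u, \sum_i `|A i u| <= c%:Z.
Hypothesis rowE : forall u, \sum_i `|E u i| <= c%:Z.
Hypothesis colE : forall i, \sum_u `|E u i| <= c%:Z.
Hypothesis c0 : (0 < c)%N.

Lemma gram_row i : \sum_j `|gram i j| <= (2 * c ^ 2)%:Z.
Proof.
have cc : (2 * c ^ 2)%:Z = c%:Z * c%:Z + c%:Z * c%:Z.
  by rewrite mulSn mul1n -mulnn PoszD PoszM.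
rewrite cc; apply: (@le_trans _ _ (\sum_j (\sum_u `|A i u| * `|A j u| +
   \sum_u `|E u i| * `|E u j|))).
  apply: ler_sum => j _; rewrite !mxE; apply: (le_trans (ler_normD _ _)).
  apply: lerD; apply: (le_trans (ler_norm_sum _ _ _)); apply: ler_sum => u _.
    by rewrite normrM mxE.
  by rewrite normrM mxE.
rewrite big_split /=; apply: lerD; rewrite exchange_big /=.
  apply: (@le_trans _ _ (\sum_u `|A i u| * c%:Z)).
    by apply: ler_sum => u _; rewrite -mulr_sumr ler_wpM2l.
  by rewrite -mulr_suml ler_wpM2r.
apply: (@le_trans _ _ (\sum_u `|E u i| * c%:Z)).
  by apply: ler_sum => u _; rewrite -mulr_sumr ler_wpM2l.
by rewrite -mulr_suml ler_wpM2r.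
Qed.

Import Num.Def.
Let toC : {rmorphism int -> algC} := intr.
Let M : 'M[algC]_n := map_mx toC gram.
Let MA : 'M[algC]_(n, m) := map_mx toC A.
Let ME : 'M[algC]_(l, n) := map_mx toC E.

Let conj_int p r (B : 'M[int]_(p, r)) : map_mx conjC (map_mx toC B) = map_mx toC B.
Proof. by apply/matrixP => i j; rewrite !mxE; exact: rmorph_int. Qed.

Let MEq : M = MA *m MA^T + ME^T *m ME.
Proof. by rewrite /M /gram map_mxD !map_mxM !map_trmx. Qed.

Let P := spectralmx M.
Let D := spectral_diag M.

Let Msym : M^T = M.
Proof. by rewrite MEq linearD /= !trmx_mul !trmxK. Qed.

Let Mspec : M = invmx P *m diag_mx D *m P.
Proof.
by apply/orthomx_spectralP/normalmxP; rewrite Msym /M conj_int.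
Qed.

Let Punit : P \in unitmx.
Proof. exact: spectral_unit. Qed.

Let v i := row i P.

Let vM i : v i *m M = D 0 i *: v i.
Proof.
rewrite /v -row_mul {1}Mspec !mulmxA mulmxV// mul1mx.
apply/rowP => j; rewrite !mxE (bigD1 i)//= big1 ?addr0 => [|t ti].
  by rewrite !mxE eqxx mulr1n.
by rewrite !mxE eq_sym (negbTE ti) mulr0n mul0r.
Qed.

Let sq p (w : 'rV[algC]_p) := \sum_j `|w 0 j| ^+ 2.

Let sqE p (w : 'rV[algC]_p) : (w *m w^t*) 0 0 = sq w.
Proof. by rewrite mxE; apply: eq_bigr => j _; rewrite !mxE normCK. Qed.

Let sq_ge0 p (w : 'rV[algC]_p) : 0 <= sq w.
Proof. by apply: sumr_ge0 => j _; rewrite exprn_ge0. Qed.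

Let sqv i : sq (v i) = 1.
Proof.
have /unitarymxP /matrixP /(_ i i) := spectral_unitarymx M.
rewrite !mxE eqxx => h; rewrite -sqE !mxE; rewrite -[RHS]h.
by apply: eq_bigr => j _; rewrite !mxE.
Qed.

Let D_ge0 i : 0 <= D 0 i.
Proof.
have -> : D 0 i = sq (v i *m MA) + sq (v i *m ME^T).
  rewrite -[LHS]mulr1 -(sqv i) -!sqE.
  have -> : D 0 i * (v i *m (v i)^t*) 0 0 = (v i *m M *m (v i)^t*) 0 0.
    by rewrite vM -scalemxAl [RHS]mxE.
  have MAc : map_mx conjC MA^T = MA^T by rewrite -map_trmx conj_int.
  have MEc : map_mx conjC ME = ME by rewrite conj_int.
  rewrite !trmx_mul trmxK !map_mxM MAc MEc MEq mulmxDr mulmxDl [LHS]mxE.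
  by rewrite !mulmxA.
by rewrite addr_ge0.
Qed.

(** Compare the l1 norms of both sides of [vM]: the absolute row sums of the matrix bound its action
    on row vectors in this norm. *)
Let D_le i : D 0 i <= (2 * c ^ 2)%:R.
Proof.
pose s := \sum_j `|v i 0 j|.
have s0 : 0 < s.
  have s0 : 0 <= s by apply: sumr_ge0.
  rewrite lt_neqAle s0 andbT eq_sym; apply/eqP => sz.
  have := sqv i; rewrite /sq big1 => [/eqP|j _]; first by rewrite eq_sym oner_eq0.
  have /psumr_eq0P/(_ sz j isT) -> : forall j, true -> 0 <= `|v i 0 j| by [].
  by rewrite expr0n.
rewrite -(ler_pM2r s0) -{1}(ger0_norm (D_ge0 i)) /s mulr_sumr.
rewrite (eq_bigr (fun j => `|(v i *m M) 0 j|)) => [|j _]; last first.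
  by rewrite vM -normrM; congr (`|_|); rewrite [RHS]mxE.
apply: (@le_trans _ _ (\sum_j \sum_t `|v i 0 t| * `|M t j|)).
  apply: ler_sum => j _; rewrite mxE; apply: (le_trans (ler_norm_sum _ _ _)).
  by apply: ler_sum => t _; rewrite normrM.
rewrite exchange_big /= mulr_sumr; apply: ler_sum => t _.
rewrite -mulr_sumr mulrC ler_wpM2r//.
have := gram_row t; rewrite -(ler_int algC) rmorph_sum/=.
rewrite [X in X <= _ -> _](eq_bigr (fun j => `|M t j|))// => j _.
by rewrite [X in _ = `|X|]mxE; exact: intr_norm.
Qed.

Let char_polyM : char_poly M = \prod_i ('X - (D 0 i)%:P).
Proof.
have -> : char_poly M = char_poly (diag_mx D).
  have PP : map_mx polyC (invmx P) *m map_mx polyC P = 1%:M.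
    by rewrite -map_mxM mulVmx// map_mx1.
  have XM : 'X%:M - map_mx polyC M = map_mx polyC (invmx P) *m
      ('X%:M - map_mx polyC (diag_mx D)) *m map_mx polyC P.
    rewrite mulmxBr mulmxBl {1}Mspec !map_mxM; congr (_ - _).
    by rewrite scalar_mxC -mulmxA PP mulmx1.
  rewrite /char_poly /char_poly_mx XM !det_mulmx mulrAC -det_mulmx PP det1 mul1r//.
rewrite char_poly_trig ?diag_mx_is_trig//.
by apply: eq_bigr => i _; rewrite mxE eqxx mulr1n.
Qed.

Let prod_D_ge1 : 1 <= \prod_(i | D 0 i != 0) D 0 i.
Proof.
(* The multiplicity of the eigenvalue 0. The characteristic polynomial is ['X^z] times a factor
   whose constant term is, up to sign, the product of the nonzero eigenvalues. *)
pose z := #|[pred i | D 0 i == 0]|.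
have nz : \prod_(i | D 0 i != 0) D 0 i != 0 by apply/prodf_neq0.
have pE : `|(char_poly M)`_z| = \prod_(i | D 0 i != 0) D 0 i.
  rewrite char_polyM (bigID (fun i => D 0 i == 0))/=.
  rewrite [X in X * _](_ : _ = 'X^z); last first.
    rewrite (eq_bigr (fun=> 'X)) => [|i /eqP ->]; last by rewrite polyC0 subr0.
    by rewrite prodr_const.
  rewrite coefXnM ltnn subnn -horner_coef0 horner_prod normr_prod.
  by apply: eq_bigr => i _; rewrite hornerXsubC sub0r normrN ger0_norm.
rewrite -pE in nz *; move: nz; rewrite -map_char_poly coef_map/=.
rewrite -intr_norm ler1z intr_eq0 normr_eq0 => nz.
by rewrite -gtz0_ge1 normr_gt0.
Qed.

Definition smooth_mx (F : numFieldType) : 'M[F]_n :=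
  1%:M - (2 * c ^ 2)%:R^-1 *: map_mx intr gram.

Let y i := (2 * c ^ 2)%:R^-1 * D 0 i.

Let smoothC_spec k : smooth_mx algC ^+ k =
  invmx P *m diag_mx (\row_i (1 - y i) ^+ k) *m P.
Proof.
have S1 : smooth_mx algC = invmx P *m diag_mx (\row_i (1 - y i)) *m P.
  rewrite (_ : diag_mx _ = 1%:M - (2 * c ^ 2)%:R^-1 *: diag_mx D); last first.
    apply/matrixP => i j; rewrite !mxE.
    by case: eqP => [_|_]; rewrite ?mulr1n// !mulr0n mulr0 subr0.
  rewrite mulmxBr mulmxBl mulmx1 mulVmx// -scalemxAr -scalemxAl.
  by rewrite /smooth_mx -[map_mx _ _]/M -[in RHS]Mspec.
elim: k => [|k IH].
  rewrite expr0 (_ : diag_mx _ = 1%:M) ?mulmx1 ?mulVmx//.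
  by apply/matrixP => i j; rewrite !mxE.
rewrite exprS IH S1 -[LHS]/(_ *m _) !mulmxA.
rewrite -(mulmxA _ P) mulmxV// mulmx1 -[X in X *m _ = _]mulmxA.
congr (_ *m _ *m _); apply/matrixP => i j; rewrite mul_diag_mx !mxE exprS.
by case: eqP => [->|_]; rewrite ?mulr1n// !mulr0n mulr0.
Qed.

Let trC k : \tr (smooth_mx algC ^+ k) = \sum_i (1 - y i) ^+ k.
Proof.
rewrite smoothC_spec -mulmxA mxtrace_mulC -mulmxA mulmxV// mulmx1 mxtrace_diag.
by apply: eq_bigr => i _; rewrite mxE.
Qed.

Let trace_gapC q j k : (0 < q)%N ->
  \tr (smooth_mx algC ^+ k) - \tr (smooth_mx algC ^+ j) <=
    n%:R * (q%:R^-1 + (1 - (2 * c ^ 2)%:R^-1 ^+ q) ^+ k).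
Proof.
move=> q0; rewrite !trC.
have C1 : 1 < (2 * c ^ 2)%:R :> algC.
  have : (0 < c ^ 2)%N by rewrite expn_gt0 c0.
  by rewrite ltr1n mul2n; case: (c ^ 2)%N.
have C0 : 0 < (2 * c ^ 2)%:R :> algC by exact: lt_trans ltr01 C1.
apply: small_eigenvalues_gap => //.
- by rewrite invr_gt0 C0 invf_lt1.
- move=> i; rewrite mulr_ge0 ?invr_ge0 ?(ltW C0)//=.
  by rewrite ler_pdivrMl// mulr1.
- have yn0 i : (y i != 0) = (D 0 i != 0).
    by rewrite mulf_eq0 invr_eq0 gt_eqF.
  rewrite (eq_bigl _ _ yn0) big_split /= prodr_const.
  (* Dividing by the norm bound costs one factor per nonzero eigenvalue, hence at most [n]
     factors. *)
  apply: le_trans (ler_peMr _ prod_D_ge1); last first.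
    by rewrite exprn_ge0// invr_ge0 ltW.
  apply: ler_wiXn2l; rewrite ?invr_ge0 ?(ltW C0)//.
    by rewrite invf_le1// ltW.
  by rewrite -[leqRHS]card_ord max_card.
Qed.

(** Rationality of the traces is the bridge from the algebraic numbers, where the matrix is
    diagonalised, to an arbitrary [F]. *)
Let tr_ratr (F : numFieldType) k :
  \tr (smooth_mx F ^+ k) = ratr (\tr (smooth_mx rat ^+ k)).
Proof.
rewrite -trace_map_mx; congr (\tr _).
have S1 : smooth_mx F = map_mx ratr (smooth_mx rat).
  rewrite /smooth_mx map_mxB map_mx1 map_mxZ fmorphV rmorph_nat -map_mx_comp.
  congr (_ - _ *: _); apply/matrixP => i j; rewrite [LHS]mxE [RHS]mxE /=.
  by rewrite ratr_int.
elim: k => [|k IH]; first by rewrite !expr0 map_mx1.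
by rewrite !exprS IH S1; symmetry; exact: map_mxM.
Qed.

Lemma trace_smooth_gap (F : numFieldType) q j k : (0 < q)%N ->
  \tr (smooth_mx F ^+ k) - \tr (smooth_mx F ^+ j) <=
    n%:R * (q%:R^-1 + (1 - (2 * c ^ 2)%:R^-1 ^+ q) ^+ k).
Proof.
move=> q0.
have bE (G : numFieldType) e : n%:R * (q%:R^-1 + (1 - e%:R^-1 ^+ q) ^+ k) =
    ratr (n%:R * (q%:R^-1 + (1 - e%:R^-1 ^+ q) ^+ k)) :> G.
  rewrite [RHS]rmorphM /= rmorphD /= rmorphXn /= rmorphB /= rmorph1 rmorphXn /=.
  by rewrite !fmorphV /= !rmorph_nat.
have h := trace_gapC j k q0; rewrite (bE algC) !(tr_ratr algC) -rmorphB ler_rat in h.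
by rewrite (bE F) !(tr_ratr F) -rmorphB ler_rat.
Qed.

End integer_matrix_gap.

Arguments bdk : simpl never.

Section integer_boundary.
Variables (R : realType) (K : complex) (p : nat).
Local Open Scope ring_scope.
Implicit Types s t : {fset nat}.

(** An integer preimage of the entries 0, 1 and -1 of [bdk], since [incidence] takes its values in
    [R]. *)
Definition ibdk t s : int :=
  if bdk R K p t s == 0 then 0 else if bdk R K p t s == 1 then 1 else -1.

Lemma ibdkE t s : (ibdk t s)%:~R = bdk R K p t s.
Proof.
rewrite /ibdk; have [->//|b0] := eqVneq (bdk R K p t s) 0.
have [->//|b1] := eqVneq (bdk R K p t s) 1.
have [_ _ [v vs tE]] := bdk_neq0 b0.
move: b0 b1; rewrite /bdk; case: p => [|q]; first by rewrite eqxx.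
case: asboolP => [_|]; last by rewrite eqxx.
rewrite tE incidence_face// -signr_odd; case: (odd _); first by rewrite expr1.
by rewrite expr0 eqxx.
Qed.

Lemma ibdk_le1 t s : `|ibdk t s| <= 1.
Proof. by rewrite /ibdk; case: ifP => // _; case: ifP. Qed.

Lemma ibdk_neq0 t s : (ibdk t s != 0) = (bdk R K p t s != 0).
Proof. by rewrite -ibdkE intr_eq0. Qed.

End integer_boundary.

Lemma sum_norm_supp (I : choiceType) (r : seq I) (a : I -> int) (F : {fset I}) :
  uniq r -> (forall t, `|a t| <= 1)%R -> (forall t, (a t != 0)%R -> t \in F) ->
  (\sum_(t <- r) `|a t| <= (#|` F|)%:Z)%R.
Proof.
move=> ur a1 aF.
apply: (@le_trans _ _ (\sum_(t <- r) (a t != 0)%:R)%R).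
  apply: ler_sum => t _; have [->|_] /= := eqVneq (a t) 0%R; first by rewrite normr0.
  exact: a1.
rewrite -natr_sum natz lez_nat -big_mkcond /= sum1_count -size_filter.
apply: uniq_leq_size; first exact: filter_uniq.
by move=> t; rewrite mem_filter => /andP[/aF].
Qed.

(** * The trace estimate on a finite complex *)

Section finite_complex.
Variables (R : realType) (d p : nat) (K : fcomplex).
Local Open Scope ring_scope.
Implicit Types (s t : {fset nat}) (x k : nat).

Let M := trunc d K.
Let c := (2 ^ d.+1)%N.
Let bM q : bker c (bdk R M q) := @bdk_bker R M d (@trunc_deg_le d K) q.
(** All subsets of the vertex set index both the faces and the cofaces of [p]-simplices; the entries
    at other subsets are zero and do not affect the Gram matrix. *)
Let X := fpowerset (fverts K).
Let P := [fset s in X | `[< simp M p s >]]%fset.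

Let memV v : v \in fverts K <-> verts K v.
Proof. by rewrite /fverts in_fset_set ?inE//; exact: finite_verts. Qed.

Let simplexX s : K s -> s \in X.
Proof.
move=> Ks; rewrite /X fpowersetE; apply/fsubsetP => v vs.
by apply/memV; apply: simplex_vert Ks vs.
Qed.

Let simpX s : M s -> s \in X.
Proof. by move=> [/simplexX]. Qed.

Let memP s : s \in P <-> simp M p s.
Proof.
rewrite /P !inE /=; split=> [/andP[_ /asboolP]//|Ms].
by apply/andP; split; [case: Ms => /simpX|exact/asboolP].
Qed.

Let n := size P.
Let m := size X.
Let s_ (i : 'I_n) : {fset nat} := nth fset0 P i.
Let t_ (u : 'I_m) : {fset nat} := nth fset0 X u.

Let sumP (T : nmodType) (a : {fset nat} -> T) : \sum_(s <- P) a s = \sum_i a (s_ i).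
Proof. by rewrite (big_nth fset0) big_mkord. Qed.

Let sumX (T : nmodType) (a : {fset nat} -> T) : \sum_(t <- X) a t = \sum_u a (t_ u).
Proof. by rewrite (big_nth fset0) big_mkord. Qed.

(** [A] and [E] are the transposes of the boundary matrices in degrees [p] and [p.+1], so that
    [gram] is the matrix of the Hodge Laplacian. *)
Let A : 'M[int]_(n, m) := \matrix_(i, u) ibdk R M p (t_ u) (s_ i).
Let E : 'M[int]_(m, n) := \matrix_(u, i) ibdk R M p.+1 (s_ i) (t_ u).
Let S := smooth_mx c A E R.

Let sP i : simp M p (s_ i).
Proof. by apply/memP; exact: mem_nth. Qed.

Let sum_le (r : seq {fset nat}) q (a : {fset nat} -> int) (F : {fset {fset nat}}) :
  uniq r -> (#|` F| <= c)%N -> (forall t, `|a t| <= 1) ->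
  (forall t, a t != 0 -> t \in F) -> q = \sum_(t <- r) `|a t| -> q <= c%:Z.
Proof.
move=> ur Fc a1 aF ->; apply: le_trans (sum_norm_supp ur a1 aF) _.
by rewrite lez_nat.
Qed.

Let rowA i : \sum_u `|A i u| <= c%:Z.
Proof.
have [_ _ /(_ (s_ i))[F Fc FP]] := bM p.
apply: (@sum_le X _ (fun t => ibdk R M p t (s_ i)) F) => //.
- exact: fset_uniq.
- by move=> t; exact: ibdk_le1.
- by move=> t; rewrite ibdk_neq0; exact: FP.
- by rewrite sumX; apply: eq_bigr => u _; rewrite mxE.
Qed.

Let colA u : \sum_i `|A i u| <= c%:Z.
Proof.
have [_ /(_ (t_ u))[F Fc FP] _] := bM p.
apply: (@sum_le P _ (fun s => ibdk R M p (t_ u) s) F) => //.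
- exact: fset_uniq.
- by move=> t; exact: ibdk_le1.
- by move=> t; rewrite ibdk_neq0; exact: FP.
- by rewrite sumP; apply: eq_bigr => i _; rewrite mxE.
Qed.

Let rowE u : \sum_i `|E u i| <= c%:Z.
Proof.
have [_ _ /(_ (t_ u))[F Fc FP]] := bM p.+1.
apply: (@sum_le P _ (fun s => ibdk R M p.+1 s (t_ u)) F) => //.
- exact: fset_uniq.
- by move=> t; exact: ibdk_le1.
- by move=> t; rewrite ibdk_neq0; exact: FP.
- by rewrite sumP; apply: eq_bigr => i _; rewrite mxE.
Qed.

Let colE i : \sum_u `|E u i| <= c%:Z.
Proof.
have [_ /(_ (s_ i))[F Fc FP] _] := bM p.+1.
apply: (@sum_le X _ (fun t => ibdk R M p.+1 (s_ i) t) F) => //.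
- exact: fset_uniq.
- by move=> t; exact: ibdk_le1.
- by move=> t; rewrite ibdk_neq0; exact: FP.
- by rewrite sumX; apply: eq_bigr => u _; rewrite mxE.
Qed.

Let hodgeE (f : chain R) j : (forall s, ~ simp M p s -> f s = 0) ->
  hodge (bdk R M p) (bdk R M p.+1) f (s_ j) =
  \sum_i f (s_ i) * (gram A E i j)%:~R.
Proof.
move=> fM; rewrite -[LHS]/(kapp _ _ _ + kapp _ _ _).
have fP t B : kapp B f t = \sum_i B t (s_ i) * f (s_ i).
  rewrite (@kapp_supp _ _ _ _ P) ?sumP// => s; rewrite mulf_eq0 negb_or.
  move=> /andP[_ fs]; apply/memP; apply: contrapT => /fM f0.
  by rewrite f0 eqxx in fs.
rewrite (@kapp_fin _ _ _ _ X); last first.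
  rewrite /trk => t /bdk_neq0[_ [Ms _] [v _ ->]].
  rewrite /X fpowersetE; apply: fsubset_trans (fsubsetDl _ _) _.
  by have := simpX Ms; rewrite fpowersetE.
rewrite (@kapp_fin _ _ _ _ X); last first.
  by move=> t /bdk_neq0[_ [Ms _] _]; exact: simpX.
rewrite !sumX.
under eq_bigr do rewrite fP mulr_sumr.
under [X in _ + X]eq_bigr do rewrite fP mulr_sumr.
rewrite exchange_big [X in _ + X]exchange_big /= -big_split /=.
apply: eq_bigr => i _; rewrite !mxE rmorphD !rmorph_sum /= mulrDr !mulr_sumr.
congr (_ + _); apply: eq_bigr => u _; rewrite !mxE rmorphM /= !ibdkE /trk; ring.
Qed.

Let iterE k i j : iter k (smooth c (bdk R M p) (bdk R M p.+1))
  (basis_chain R (s_ i)) (s_ j) = (S ^+ k) i j.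
Proof.
elim: k j => [|k IH] j.
  rewrite expr0 !mxE /= /basis_chain /s_ nth_uniq//; last exact: fset_uniq.
  by rewrite eq_sym.
rewrite iterS exprSr -[in RHS]/(_ *m _) mxE.
set f := iter _ _ _ in IH *.
have fM s : ~ simp M p s -> f s = 0.
  apply: iter_smooth_supp => u Mu; rewrite /basis_chain.
  by case: eqP Mu => // ->.
rewrite -[LHS]/(f (s_ j) - _^-1 * hodge _ _ f (s_ j)) hodgeE// IH mulr_sumr.
have SE l : S l j = (l == j)%:R - (2 * c ^ 2)%:R^-1 * (gram A E l j)%:~R.
  by rewrite /S /smooth_mx; set G := gram A E; rewrite !mxE.
rewrite [RHS](eq_bigr (fun l => (S ^+ k) i l * (l == j)%:R -
   (2 * c ^ 2)%:R^-1 * ((S ^+ k) i l * (gram A E l j)%:~R))); last first.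
  by move=> l _; rewrite SE mulrBr mulrCA.
rewrite sumrB [X in _ = X - _](bigD1 j)//= eqxx mulr1.
rewrite [X in _ = _ + X - _]big1 ?addr0 => [|l /negbTE ->]; last by rewrite mulr0.
by congr (_ - _); apply: eq_bigr => l _; rewrite IH.
Qed.

Let S_sym k : (S ^+ k)^T = S ^+ k.
Proof.
have S1 : S^T = S.
  rewrite /S /smooth_mx linearB /= trmx1 linearZ /= map_trmx /gram.
  by rewrite linearD /= !trmx_mul !trmxK.
elim: k => [|k IH]; first by rewrite expr0 trmx1.
by rewrite {1}exprS -[LHS]/((_ *m _)^T) trmx_mul IH S1 exprSr.
Qed.

(** The squared norm of a row of the symmetric matrix [S ^+ k] is a diagonal entry of its square. *)
Let heat_trace k : \sum_(s <- P) simplex_heat R d p k K s = \tr (S ^+ k.*2).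
Proof.
rewrite sumP; apply: eq_bigr => i _.
have lk := iter_smooth_l2 (bM p) (bM p.+1) k (l2_basis R (s_ i)).
rewrite /simplex_heat /heat (@dot_fin _ _ _ P)//; last first.
  move=> s sP'; apply: (@iter_smooth_supp R M d p) => [u Mu|].
    by rewrite /basis_chain; case: eqP Mu => // ->.
  by move=> /memP; exact/negP.
rewrite sumP -addnn exprD -[in RHS]/(_ *m _) mxE; apply: eq_bigr => j _.
by rewrite !iterE; congr (_ * _); rewrite -[in RHS]S_sym [RHS]mxE.
Qed.

(** Double counting: each [p]-simplex is seen from its [p.+1] vertices, which cancels the
    normalising denominator. *)
Let heat_sum k : \sum_(x <- fverts K) heat_density R d p k K x =
  \sum_(s <- P) simplex_heat R d p k K s.
Proof.
have hE x : heat_density R d p k K x =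
    \sum_(s <- P) (x \in s)%:R * (simplex_heat R d p k K s / p.+1%:R).
  rewrite /heat_density fsbig_mkcond -(fsbig_widen [set` P] setT)//.
    rewrite -fsbig_seq//; apply: eq_big_seq => s /memP Ms; rewrite /patch.
    have [xs|xs] := boolP (x \in s).
      by rewrite mul1r ifT//; apply/mem_set.
    by rewrite mul0r ifF//; apply/negP => /set_mem[_]; exact/negP.
  move=> s [_ sP']; rewrite /= /patch ifF//; apply/negP => /set_mem[/memP sP'' _].
  exact: sP'.
under eq_bigr do rewrite hE.
rewrite exchange_big /=; apply: eq_big_seq => s /memP[[Ks _] sp].
rewrite -mulr_suml -natr_sum.
rewrite (_ : (\sum_(x <- fverts K) (x \in s))%N = p.+1); last first.
  rewrite -sp -big_mkcond /= sum1_count -size_filter; apply: perm_size.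
  apply: uniq_perm; rewrite ?filter_uniq ?fset_uniq// => x.
  rewrite mem_filter; apply/andP/idP => [[]//|xs]; split=> //.
  by apply/memV; apply: simplex_vert Ks xs.
by rewrite mulrC divfK// pnatr_eq0.
Qed.

Lemma finite_heat_gap q j k : (0 < q)%N ->
  \sum_(x <- fverts K) heat_density R d p k K x -
  \sum_(x <- fverts K) heat_density R d p j K x <=
  (#|` fverts K|)%:R * (c%:R * (q%:R^-1 + (1 - (2 * c ^ 2)%:R^-1 ^+ q) ^+ k.*2)).
Proof.
move=> q0; rewrite !heat_sum !heat_trace.
have c0 : (0 < c)%N by rewrite expn_gt0.
apply: le_trans (trace_smooth_gap rowA colA rowE colE c0 R j.*2 k.*2 q0) _.
rewrite mulrA ler_wpM2r//.
  rewrite addr_ge0 ?invr_ge0// exprn_ge0// subr_ge0 exprn_ile1 ?invr_ge0//.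
  by rewrite invf_le1 ?ler1n ?ltr0n muln_gt0/= expn_gt0 c0.
(* At time 0 every simplex has heat 1, so the density counts simplices; its pointwise bound then
   gives at most [c] simplices per vertex. *)
have -> : n%:R = \sum_(x <- fverts K) heat_density R d p 0 K x.
  rewrite heat_sum (eq_bigr (fun=> 1)); last first.
    move=> s _; rewrite /simplex_heat /heat /= dot_basisl ?/basis_chain ?eqxx//.
    exact: l2_basis.
  by rewrite big_const_seq count_predT iter_addr_0.
apply: (@le_trans _ _ (\sum_(x <- fverts K) c%:R)).
  by apply: ler_sum => x _; exact: heat_density_le.
by rewrite big_const_seq count_predT iter_addr_0 mulr_natl.
Qed.

End finite_complex.

(** * Integration and weak convergence *)

Section local_functions.
Variable R : realType.
Local Open Scope ring_scope.
Implicit Types c : SC R.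

Lemma SCdist_balls_isom c1 c2 r : SCdist c1 c2 < 2^-1 ^+ r -> balls_isom c1 c2 r.
Proof.
have Ane : [set (2^-1 : R) ^+ r | r in balls_isom c1 c2] !=set0.
  by exists 1, 0%N; [apply: isom_cball0; exact: root_verts|rewrite expr0].
move=> /(inf_lt Ane)[_ [s sB <-] sr].
apply: isom_cball_le sB; try exact: root_verts.
rewrite leqNgt; apply/negP => /ltnW rs; move: sr; rewrite ltNge => /negP; apply.
by apply: ler_wiXn2l; rewrite ?invr_ge0// invf_le1// ler1n.
Qed.

(** Functions on [SC] are computed on a chosen representative, about which nothing else is known.
    Dependence on a ball makes them locally constant, whence both continuity and Borel
    measurability. *)
Definition ball_local (T : Type) (r : nat) (f : SC R -> T) :=
  forall c1 c2, balls_isom c1 c2 r -> f c1 = f c2.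

Lemma ball_local_near T r (f : SC R -> T) c : ball_local r f ->
  \forall c' \near c, f c' = f c.
Proof.
move=> fr; have h : 0 < 2^-1 ^+ r :> R by rewrite exprn_gt0// invr_gt0.
near=> c'; symmetry; apply: fr; apply: SCdist_balls_isom.
near: c'; have := nbhsx_ballx c _ h; rewrite ballEmdist; exact.
Unshelve. all: by end_near. Qed.

Lemma ball_local_open T r (f : SC R -> T) (B : set T) : ball_local r f ->
  open (f @^-1` B).
Proof.
move=> fr; rewrite openE => c Bc; rewrite /interior.
by apply: filterS (ball_local_near c fr) => c' /= ->.
Qed.

Lemma ball_local_continuous r (f : SC R -> R) : ball_local r f -> continuous f.
Proof.
by move=> fr c; apply: cvg_near_cst; [exact: nbhs_filter|exact: ball_local_near fr].
Qed.

Lemma ball_local_measurable_set T r (f : SC R -> T) (B : set T) : ball_local r f ->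
  measurable (f @^-1` B).
Proof. by move=> fr; apply: sub_sigma_algebra; exact: ball_local_open fr. Qed.

Lemma ball_local_measurable r (f : SC R -> R) : ball_local r f ->
  measurable_fun setT f.
Proof. by move=> fr _ B _; rewrite setTI; exact: ball_local_measurable_set fr. Qed.

End local_functions.

Section almost_everywhere.
Local Open Scope ring_scope.
Local Open Scope ereal_scope.
Context d (T : measurableType d) (R : realType) (mu : {measure set T -> \bar R}).
Import HBNNSimple.

(* Neither [f] nor [g] is assumed measurable, which excludes [ae_eq_integral]. *)
Lemma integral_eq_on (G : set T) (f g : T -> \bar R) : measurable G ->
  mu (~` G) = 0 -> (forall x, G x -> f x = g x) ->
  \int[mu]_x f x = \int[mu]_x g x.
Proof.
move=> mG G0.
have le (u v : T -> \bar R) : (forall x, 0 <= u x) -> (forall x, 0 <= v x) ->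
    (forall x, G x -> u x = v x) -> \int[mu]_x u x <= \int[mu]_x v x.
  move=> u0 v0 uv; rewrite [leLHS]ge0_integralTE//.
  apply: ge_ereal_sup => _ [h /= hu <-].
  (* Cutting the simple function [h] down to [G] keeps its integral, as [G] has full measure, and
     puts it below [v] everywhere. *)
  pose h' := proj_nnsfun h mG.
  have hE : sintegral mu h = \int[mu]_x (h x)%:E.
    by rewrite integral_nnsfun// patch_setT.
  have h'E : sintegral mu h' = \int[mu]_x (h' x)%:E.
    by rewrite integral_nnsfun// patch_setT.
  have -> : sintegral mu h = sintegral mu h'.
    rewrite hE h'E; apply: ae_eq_integral => //.
      by apply/measurable_EFinP.
      by apply/measurable_EFinP.
    exists (~` G); split => //; first exact: measurableC.
    move=> x /= xh Gx; apply: xh => _.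
    by rewrite /h' /= mindicE mem_set// mulr1.
  rewrite ge0_integralTE//; apply: ereal_sup_ubound; exists h' => // x.
  rewrite /h' /= mindicE; have [xG|xG] := boolP (x \in G).
    by rewrite mulr1 -uv//; exact: set_mem.
  by rewrite mulr0.
move=> fg; rewrite integralE [RHS]integralE.
have eqi (u v : T -> \bar R) : (forall x, 0 <= u x) -> (forall x, 0 <= v x) ->
    (forall x, G x -> u x = v x) -> \int[mu]_x u x = \int[mu]_x v x.
  by move=> u0 v0 uv; apply/eqP; rewrite eq_le !le// => x /uv.
congr (_ - _); apply: eqi => // x Gx.
  by rewrite !funeposE fg.
by rewrite !funenegE fg.
Qed.

End almost_everywhere.

Section isomorphic_balls.
Implicit Types (K L : complex) (x y r : nat) (f : nat -> nat).

Lemma dist_le_isom f K x L y r v : verts K x -> is_isom f K x L y ->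
  dist_le K r x v -> dist_le L r y (f v).
Proof.
move=> Kx [[ff fi _] fx fs]; move: r v; apply: dist_le_ind => [r|r u v _ du uv].
  by rewrite fx; exact: dist_le0.
have Ku := adj_vertsl uv; have Kv := adj_vertsr uv.
apply: dist_leS du _; have [uv0 Kuv] := uv; split.
  by apply: contra_neq uv0; apply: fi; exact/mem_set.
rewrite -imfset_fset2; apply/fs => // w.
by rewrite !inE => /orP[] /eqP ->.
Qed.

Lemma isom_cball K x L y r : verts K x -> verts L y -> isom K x L y ->
  isom (cball K x r) x (cball L y r) y.
Proof.
move=> Kx Ly [f fI]; have [g gI [fg gf]] := is_isom_inv Kx fI.
have fd v : dist_le K r x v -> dist_le L r y (f v) by exact: dist_le_isom fI.
have gd v : dist_le L r y v -> dist_le K r x (g v) by exact: dist_le_isom gI.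
have gfE v : dist_le K r x v -> g (f v) = v.
  by move=> /(dist_le_verts Kx) Kv; exact/gf/mem_set.
exists f; case: (fI) => -[ff fi fsj] fx fs; split=> //.
- split.
  + by move=> v /(verts_cball _ _ Kx) dv; apply/verts_cball => //; exact: fd.
  + move=> u v /set_mem/(verts_cball _ _ Kx) du /set_mem/(verts_cball _ _ Kx) dv.
    by move=> uv; rewrite -(gfE _ du) uv gfE.
  + move=> w /(verts_cball _ _ Ly) dw; exists (g w).
      by apply/verts_cball => //; exact: gd.
    by apply/fg/mem_set; exact: dist_le_verts dw.
- move=> s sB; have sd v : v \in s -> dist_le K r x v by move=> /sB/(verts_cball _ _ Kx).
  have sK v : v \in s -> verts K v by move=> /sd; exact: dist_le_verts.
  split=> -[Ks sP]; split.
  + exact/fs.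
  + by move=> _ /imfsetP[v /= /sd dv ->]; exact: fd.
  + exact/fs.
  + by move=> v /sd.
Qed.

Lemma component_id K x : connected_cplx K -> verts K x -> component K x = K.
Proof.
move=> [_ cK] Kx; apply: complex_eq; apply/funext => s; apply/propext.
split=> [[]//|Ks]; split=> // v vs; apply: cK => //; exact: simplex_vert Ks vs.
Qed.

End isomorphic_balls.

Section empirical_integral.
Local Open Scope ring_scope.
Local Open Scope ereal_scope.
Variable R : realType.

Lemma integral_empirical (K : fcomplex) (f : SC R -> R) :
  measurable_fun setT f -> (forall c, 0 <= f c)%R ->
  \int[empirical K]_c (f c)%:E = ((#|` fverts K|%:R)^-1 *
    \sum_(x : fverts K) f (iclass (rooted_component x)))%:E.
Proof.
move=> mf f0.
pose pts := [seq iclass (rooted_component x) : SC R | x <- index_enum (fverts K)].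
pose m_ i : {measure set (SC R) -> \bar R} := \d_(nth point pts i).
have k0 : (0 <= (#|` fverts K|%:R)^-1 :> R)%R by rewrite invr_ge0.
have E : forall A, measurable A -> A `<=` setT ->
    empirical K A = mscale (NngNum k0) (msum m_ (size pts)) A.
  move=> A _ _; rewrite /empirical /mscale /= /msum; congr (_ * _).
  rewrite -(big_mkord xpredT (fun i => m_ i A)) /m_.
  rewrite -(big_nth point xpredT (fun a => \d_a A)) /pts big_map.
  by [].
have mE : measurable_fun setT (EFin \o f) by exact/measurable_EFinP.
have fE0 c : [set: SC R] c -> 0 <= (EFin \o f) c by rewrite /= lee_fin.
rewrite (eq_measure_integral _ E) (ge0_integral_mscale _ measurableT _ mE)//.
rewrite (ge0_integral_measure_sum m_ measurableT fE0 mE).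
rewrite EFinM; congr (_ * _).
rewrite (eq_bigr (fun i : 'I_(size pts) => (f (nth point pts i))%:E)); last first.
  move=> i _.
  by rewrite integral_dirac ?diracT ?mul1e.
rewrite sumEFin; congr EFin.
rewrite -(big_mkord xpredT (fun i => f (nth point pts i))).
by rewrite -(big_nth point xpredT f) /pts big_map.
Qed.

End empirical_integral.

Section heat_functions.
Local Open Scope ring_scope.
Variables (R : realType) (d p : nat).
Implicit Types (c : SC R) (k j r : nat).

Definition heatf k c : R := heat_density R d p k (irepr c) (rc_root (irepr c)).

Lemma heatf_local k : ball_local k.*2.+2 (heatf k).
Proof.
move=> c1 c2 c12; apply: isom_heat_density => //; try exact: root_verts;
  exact: rc_locally_finite.
Qed.

Lemma heatf_iclass k (L : rcomplex) :
  heatf k (iclass L) = heat_density R d p k L (rc_root L).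
Proof.
apply: isom_heat_density; try exact: root_verts; try exact: rc_locally_finite.
apply: isom_cball; try exact: root_verts.
by apply/(iclassE R); rewrite ireprK.
Qed.

Lemma heatf_ge0 k c : 0 <= heatf k c.
Proof. exact: heat_density_ge0. Qed.

Lemma heatf_le k c : heatf k c <= (2 ^ d.+1)%:R.
Proof. exact: heat_density_le. Qed.

Lemma heatf_noninc c m n : (m <= n)%N -> heatf n c <= heatf m c.
Proof. exact: heat_density_noninc. Qed.

Lemma heatf_measurable k : measurable_fun setT (heatf k).
Proof. exact: ball_local_measurable (@heatf_local k). Qed.

Lemma heatf_bounded k : bounded_fun (heatf k).
Proof.
exists (2 ^ d.+1)%:R; split; first exact: num_real.
move=> M cM c _ /=; rewrite ger0_norm ?heatf_ge0//.
exact: le_trans (heatf_le k c) (ltW cM).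
Qed.

(** Simplices per vertex, times the sum of the proportion of small eigenvalues and the largest
    contribution of any other nonzero eigenvalue. *)
Definition gap_bound q k : R := (2 ^ d.+1)%:R *
  (q%:R^-1 + (1 - (2 * (2 ^ d.+1) ^ 2)%:R^-1 ^+ q) ^+ k.*2).

Lemma integral_heatf_empirical (K : fcomplex) k : connected_cplx K ->
  (\int[empirical K]_c (heatf k c)%:E)%E =
  ((#|` fverts K|%:R)^-1 * \sum_(x <- fverts K) heat_density R d p k K x)%:E.
Proof.
move=> cK; rewrite integral_empirical; [|exact: heatf_measurable|exact: heatf_ge0].
congr (_ * _)%:E; rewrite [RHS]big_seq_fsetE /=; apply: eq_bigr => x _.
rewrite heatf_iclass /=; congr heat_density; apply: component_id => //.
exact: fverts_verts.
Qed.

Lemma integral_heatf_fin (mu : probability (SC R) R) k :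
  (\int[mu]_c (heatf k c)%:E)%E \is a fin_num.
Proof.
have : mu.-integrable setT (EFin \o heatf k).
  apply: measurable_bounded_integrable => //.
  - apply: (@le_lt_trans _ _ 1%E); last by rewrite ltry.
    exact: probability_le1.
  - exact: heatf_measurable.
  - exact: heatf_bounded.
by move=> /integral_fune_fin_num; apply.
Qed.

Lemma weakly_cvg_heatf (mu_ : nat -> {measure set (SC R) -> \bar R})
    (mu : {measure set (SC R) -> \bar R}) k : weakly_cvg mu_ mu ->
  (\int[mu_ n]_c (heatf k c)%:E)%E @[n --> \oo] --> (\int[mu]_c (heatf k c)%:E)%E.
Proof.
apply; last exact: heatf_bounded.
exact: ball_local_continuous (@heatf_local k).
Qed.

Lemma sofic_heatf_gap (mu : probability (SC R) R) q j k : sofic mu -> (0 < q)%N ->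
  fine (\int[mu]_c (heatf k c)%:E)%E - fine (\int[mu]_c (heatf j c)%:E)%E <=
  gap_bound q k.
Proof.
move=> [K_ [cK Kmu]] q0.
pose r n i : R := (#|` fverts (K_ n)|%:R)^-1 *
  \sum_(x <- fverts (K_ n)) heat_density R d p i (K_ n) x.
have rcv i : r n i @[n --> \oo] --> fine (\int[mu]_c (heatf i c)%:E)%E.
  suff h : (r n i)%:E @[n --> \oo] --> (fine (\int[mu]_c (heatf i c)%:E)%E)%:E.
    exact: fine_cvg h.
  rewrite fineK; last exact: integral_heatf_fin.
  rewrite [X in X @ _](_ : _ = fun n => (\int[empirical (K_ n)]_c (heatf i c)%:E)%E).
    exact: (weakly_cvg_heatf (k := i) Kmu).
  by apply/funext => n; rewrite integral_heatf_empirical.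
have cv : r n k - r n j @[n --> \oo] -->
    fine (\int[mu]_c (heatf k c)%:E)%E - fine (\int[mu]_c (heatf j c)%:E)%E.
  by apply: cvgB; exact: rcv.
rewrite -(cvg_lim _ cv)//; apply: limr_le; first by apply/cvg_ex; eexists; exact: cv.
apply: nearW => n; rewrite /r /= -mulrBr.
have := @finite_heat_gap R d p (K_ n) q j k q0.
(* With [0^-1 = 0] the left-hand side vanishes in this case. *)
have [->|V0] := eqVneq (#|` fverts (K_ n)|) 0%N.
  move=> _; rewrite invr0 mul0r /gap_bound mulr_ge0// addr_ge0 ?invr_ge0//.
  rewrite exprn_ge0// subr_ge0 exprn_ile1 ?invr_ge0//.
  by rewrite invf_le1 ?ler1n ?ltr0n muln_gt0/= !expn_gt0.
rewrite -lter_pdivrMl; last by rewrite ltr0n lt0n.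
exact.
Qed.

Definition bounded_deg c := forall v, verts (irepr c) v -> deg_le d (irepr c) v.

(** Bounded degree is not determined by any one ball, but its failure is a countable union of these
    local, hence open and closed, conditions. *)
Definition bad_ball r c := exists2 v,
  dist_le (irepr c) r (rc_root (irepr c)) v & ~ deg_le d (irepr c) v.

Lemma bad_ball_local r : ball_local r.+1 (bad_ball r).
Proof.
have H c1 c2 : balls_isom c1 c2 r.+1 -> bad_ball r c1 -> bad_ball r c2.
  move=> [f fI] [v dv ndv].
  have K1 := root_verts (irepr c1); have K2 := root_verts (irepr c2).
  have BK : verts (rc_ball (irepr c1) r.+1) (rc_root (irepr c1)).
    by apply/verts_cball => //; exact: dist_le0.
  have [g gI [fg gf]] := is_isom_inv BK fI.
  have dfv := isom_dist_le K1 K2 fI (leqnSn r) dv.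
  exists (f v) => // dfv'; apply: ndv.
  have <- : g (f v) = v.
    by apply/gf/mem_set/verts_cball => //; exact: dist_le_leq dv.
  exact: deg_le_isom gI dfv dfv'.
move=> c1 c2 c12; apply/propext; split; first exact: H.
by apply: H; apply: isom_sym c12; apply/verts_cball; [exact: root_verts|exact: dist_le0].
Qed.

Lemma bad_ball_measurable r : measurable [set c | bad_ball r c].
Proof. exact: (ball_local_measurable_set [set P | P] (@bad_ball_local r)). Qed.

Lemma bounded_degC : ~` [set c | bounded_deg c] = \bigcup_r [set c | bad_ball r c].
Proof.
apply/seteqP; split=> c /=.
  move=> /existsNP[v /not_implyP[Kv ndv]].
  have [r dv] := (rc_connected (irepr c)).2 _ _ (root_verts (irepr c)) Kv.
  by exists r => //; exists v.
move=> [r _ [v dv ndv]] /(_ v) h; apply/ndv/h.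
exact: dist_le_verts (root_verts _) dv.
Qed.

Lemma bounded_deg_measurable : measurable [set c | bounded_deg c].
Proof.
rewrite -[X in measurable X]setCK bounded_degC; apply: measurableC.
by apply: bigcup_measurable => r _; exact: bad_ball_measurable.
Qed.

(** The indicator of [bad_ball r] is locally constant, so it is an admissible test function and its
    zero integrals pass to the limit. *)
Lemma weakly_cvg_bounded_deg (mu_ : nat -> {measure set (SC R) -> \bar R})
    (mu : {measure set (SC R) -> \bar R}) : weakly_cvg mu_ mu ->
  (forall n, mu_ n (~` [set c | bounded_deg c]) = 0%E) ->
  mu (~` [set c | bounded_deg c]) = 0%E.
Proof.
move=> wmu mu0; rewrite bounded_degC.
have mB : measurable (\bigcup_r [set c : SC R | bad_ball r c]).
  by apply: bigcup_measurable => r _; exact: bad_ball_measurable.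
suff B0 r : mu [set c | bad_ball r c] = 0%E.
  apply/negligibleP => //; apply: negligible_bigcup => r.
  by apply/negligibleP; [exact: bad_ball_measurable|exact: B0].
pose f : SC R -> R := \1_[set c | bad_ball r c].
have fl : ball_local r.+1 f.
  move=> c1 c2 /bad_ball_local E; rewrite /f !indicE; congr (_%:R).
  by congr (nat_of_bool _); apply/idP/idP => /set_mem /= h; apply/mem_set => /=;
    rewrite ?E// -E.
have fb : bounded_fun f.
  exists 1; split; first exact: num_real.
  move=> M M1 c _ /=; rewrite /f indicE ger0_norm//.
  by rewrite (le_trans _ (ltW M1))// lern1 leq_b1.
have := wmu f (ball_local_continuous fl) fb.
have IE (nu : {measure set (SC R) -> \bar R}) :
    (\int[nu]_c (f c)%:E)%E = nu [set c | bad_ball r c].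
  by rewrite /f integral_indic ?setIT//; exact: bad_ball_measurable.
rewrite IE (_ : (fun n => _) = fun=> 0%E); last first.
  apply/funext => n; rewrite IE; apply: subset_measure0 (mu0 n).
  - exact: bad_ball_measurable.
  - by apply: measurableC; exact: bounded_deg_measurable.
  - by rewrite bounded_degC => c cb; exists r.
by move=> /(cvg_lim (@ereal_hausdorff R)) <-; exact: lim_cst.
Qed.

Lemma bounded_deg_null (mu : {measure set (SC R) -> \bar R}) (D : R) :
  D <= d%:R -> (degree mu <= D%:E)%E -> mu (~` [set c | bounded_deg c]) = 0%E.
Proof.
move=> Dd /ess_supP[N [mN N0 NP]].
apply: subset_measure0 N0 => //.
  by apply: measurableC; exact: bounded_deg_measurable.
apply: subset_trans NP => c /= nc degc; apply: nc => v Kv.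
have : (deg R (irepr c) v <= d%:R%:E)%E.
  apply: (@le_trans _ _ D%:E); last by rewrite lee_fin.
  by apply: le_trans degc; apply: ereal_sup_ubound; exists v.
rewrite /deg /counting; case: ifPn => [/asboolP finA|_]; last by rewrite leye_eq.
rewrite lee_fin ler_nat => Ad.
pose A := fset_set [set s | simp (irepr c) 1 s /\ v \in s].
(* Each edge at [v] is sent to its other endpoint: the sum runs over a singleton and merely extracts
   its element. *)
exists [fset (\sum_(w <- (s `\ v)%fset) w)%N | s in A]%fset.
  by apply: leq_trans Ad; exact: leq_imfset_card.
move=> u [vu Kvu]; apply/imfsetP; exists [fset v; u]%fset => /=.
  rewrite /A in_fset_set//; apply/mem_set; split; last by rewrite !inE eqxx.
  by split=> //; rewrite cardfs2 vu.
rewrite (_ : ([fset v; u] `\ v)%fset = [fset u]%fset) ?big_seq_fset1//.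
apply/fsetP => w; rewrite !inE; have [->|wv] //= := eqVneq w v.
by rewrite (negbTE vu).
Qed.

(** Dominated convergence applies to the pointwise limit [b], which exists everywhere and is
    measurable. It agrees with the Betti density on complexes of bounded degree, where the heat
    converges to the harmonic projection. *)
Lemma betti_limit (mu : probability (SC R) R) :
  mu (~` [set c | bounded_deg c]) = 0%E ->
  (\int[mu]_c (heatf k c)%:E)%E @[k --> \oo] --> betti p mu /\
  betti p mu \is a fin_num.
Proof.
move=> G0; pose b c := limn (heatf ^~ c).
have hcv c : heatf k c @[k --> \oo] --> b c.
  apply: nonincreasing_is_cvgn; first by move=> m n mn; exact: heatf_noninc.
  by exists 0 => _ [k _ <-]; exact: heatf_ge0.
have bE : betti p mu = (\int[mu]_c (b c)%:E)%E.
  rewrite /betti; apply: (integral_eq_on bounded_deg_measurable G0) => c cd.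
  congr EFin; symmetry; apply/cvg_lim => //.
  by apply: heat_density_cvg.
have mb : measurable_fun setT b.
  apply: (measurable_fun_cvg heatf_measurable) => c _; exact: hcv.
have cst_int : mu.-integrable setT (EFin \o cst ((2 ^ d.+1)%:R : R)).
  exact: finite_measure_integrable_cst.
have [] := @dominated_convergence _ _ _ mu setT measurableT
  (fun k c => (heatf k c)%:E) (fun c => (b c)%:E) (EFin \o cst ((2 ^ d.+1)%:R : R)).
- by move=> k; apply/measurable_EFinP; exact: heatf_measurable.
- exact/measurable_EFinP.
- by apply: aeW => c _; apply: cvg_EFin; [exact: nearW|exact: hcv].
- exact: cst_int.
- apply: aeW => c k _ /=; rewrite lee_fin ger0_norm ?heatf_ge0//.
  exact: heatf_le.
move=> bint _ cv; rewrite bE; split; first exact: cv.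
exact: integral_fune_fin_num.
Qed.

End heat_functions.

(** * Exchange of the limits in time and in the sequence *)

Section convergence.
Variables (R : realType) (p : nat).
Local Open Scope ring_scope.

Lemma gap_bound_small (d : nat) (e : R) : 0 < e ->
  exists2 q : nat, (0 < q)%N & \forall k \near \oo, gap_bound R d q k <= e.
Proof.
move=> e0; set c : R := (2 ^ d.+1)%:R.
have c0 : 0 < c by rewrite ltr0n expn_gt0.
have ec0 : 0 < e / (2 * c) by rewrite divr_gt0// mulr_gt0.
(* [q] is fixed first, making the proportion of small eigenvalues negligible; only then is [k] taken
   large, as the decay rate depends on [q]. *)
pose q := (Num.truncn (e / (2 * c))^-1).+1.
exists q => //.
have q0 : 0 < q%:R :> R by rewrite ltr0n.
have qe : q%:R^-1 <= e / (2 * c).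
  rewrite -[leRHS]invrK lef_pV2 ?posrE ?invr_gt0//; apply: ltW.
  by rewrite /q truncnS_gt.
set b : R := (2 * (2 ^ d.+1) ^ 2)%:R^-1 ^+ q.
have C1 : 1 < (2 * (2 ^ d.+1) ^ 2)%:R :> R.
  have : (0 < (2 ^ d.+1) ^ 2)%N by rewrite !expn_gt0.
  by rewrite ltr1n mul2n; case: ((2 ^ d.+1) ^ 2)%N.
have C0 := lt_trans ltr01 C1.
have b0 : 0 < b by rewrite exprn_gt0// invr_gt0.
have b1 : b < 1 by rewrite exprn_ilt1 ?invr_ge0 ?(ltW C0)// invf_lt1.
have b'0 : 0 <= 1 - b by rewrite subr_ge0 ltW.
have b'1 : `|1 - b| < 1 by rewrite ger0_norm// gtrBl.
have /cvgr0Pnorm_le/(_ _ ec0) := cvg_expr b'1.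
apply: filterS => k; rewrite normrX ger0_norm// => bk.
have b2k : (1 - b) ^+ k.*2 <= e / (2 * c).
  apply: le_trans bk; apply: ler_wiXn2l => //; first by rewrite gerBl ltW.
  by rewrite -addnn leq_addr.
rewrite /gap_bound -/c -/b (_ : e = c * (e / (2 * c) + e / (2 * c))).
  by rewrite ler_pM2l// lerD.
by field; rewrite gt_eqF.
Qed.

Lemma betti_cvg (mu_ : nat -> probability (SC R) R) (mu : probability (SC R) R)
    (d : nat) : (forall n, sofic (mu_ n)) ->
  (forall n, mu_ n (~` [set c | bounded_deg d c]) = 0%E) ->
  weakly_cvg (fun n => mu_ n) mu ->
  betti p (mu_ n) @[n --> \oo] --> betti p mu.
Proof.
move=> hs mu0 hw; have mu00 := weakly_cvg_bounded_deg hw mu0.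
pose a (nu : probability (SC R) R) k := fine (\int[nu]_c (heatf d p k c)%:E)%E.
have aE (nu : probability (SC R) R) k : (\int[nu]_c (heatf d p k c)%:E)%E = (a nu k)%:E.
  by rewrite fineK//; exact: integral_heatf_fin.
have acv k : a (mu_ n) k @[n --> \oo] --> a mu k.
  suff h : (a (mu_ n) k)%:E @[n --> \oo] --> (a mu k)%:E by exact: fine_cvg h.
  rewrite -aE [X in X @ _](_ : _ = fun n => (\int[mu_ n]_c (heatf d p k c)%:E)%E).
    exact: weakly_cvg_heatf hw.
  by apply/funext => n; rewrite aE.
have bcv (nu : probability (SC R) R) : nu (~` [set c | bounded_deg d c]) = 0%E ->
    betti p nu \is a fin_num /\ a nu k @[k --> \oo] --> fine (betti p nu).
  move=> /(betti_limit p)[cv bf]; split=> //.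
  suff h : (a nu k)%:E @[k --> \oo] --> (fine (betti p nu))%:E by exact: fine_cvg h.
  rewrite fineK// [X in X @ _](_ : _ = fun k => (\int[nu]_c (heatf d p k c)%:E)%E)//.
  by apply/funext => k; rewrite aE.
have [bf bl] := bcv _ mu00.
rewrite -(fineK bf).
rewrite [X in X @ _](_ : _ = fun n => (fine (betti p (mu_ n)))%:E); last first.
  by apply/funext => n; rewrite fineK//; have [] := bcv _ (mu0 n).
apply: cvg_EFin; first exact: nearW.
apply/cvgrPdist_le => e e0.
have e3 : 0 < e / 3 by rewrite divr_gt0.
have [q q0 qk] := gap_bound_small d e3.
have kl : \forall k \near \oo, `|fine (betti p mu) - a mu k| <= e / 3.
  by move/cvgrPdist_le : bl; exact.
(* The time [k] must not depend on [n]: the first condition serves all [mu_ n] at once, the second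
   concerns only the limit measure. *)
have [k [kq km]] : exists k, gap_bound R d q k <= e / 3 /\
    `|fine (betti p mu) - a mu k| <= e / 3.
  have [[N1 _ h1] [N2 _ h2]] := (qk, kl); exists (maxn N1 N2).
  by split; [apply: h1 => /=; exact: leq_maxl|apply: h2 => /=; exact: leq_maxr].
have /cvgrPdist_le/(_ _ e3) := acv k.
apply: filterS => n an.
have [bfn bln] := bcv _ (mu0 n).
(* The bound of [sofic_heatf_gap] does not depend on [j], so [j] can tend to infinity; for [j >= k]
   monotonicity makes the difference nonnegative. *)
have gapn : `|a (mu_ n) k - fine (betti p (mu_ n))| <= e / 3.
  have cv : `|a (mu_ n) k - a (mu_ n) j| @[j --> \oo] -->
      `|a (mu_ n) k - fine (betti p (mu_ n))|.
    by apply: cvg_norm; apply: cvgB; [exact: cvg_cst|exact: bln].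
  rewrite -(cvg_lim _ cv)//; apply: limr_le; first by apply/cvg_ex; eexists; exact: cv.
  near=> j; rewrite ger0_norm; last first.
    rewrite subr_ge0 /a fine_le ?integral_heatf_fin//.
    apply: ge0_le_integral => //.
    - by move=> c _; rewrite lee_fin heatf_ge0.
    - by apply/measurable_EFinP; exact: heatf_measurable.
    - by apply/measurable_EFinP; exact: heatf_measurable.
    - move=> c _; rewrite lee_fin heatf_noninc//.
      by near: j; exact: nbhs_infty_ge.
  exact: le_trans (sofic_heatf_gap d p j k (hs n) q0) kq.
rewrite (_ : e = e / 3 + (e / 3 + e / 3)); last by field.
apply: le_trans (ler_distD (a mu k) _ _) _; apply: lerD => //.
apply: le_trans (ler_distD (a (mu_ n) k) _ _) _; exact: lerD.
Unshelve. all: by end_near. Qed.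

End convergence.

Local Open Scope ereal_scope.

Theorem mainTheorem1 (R : realType) (mu_ : nat -> probability (SC R) R)
    (mu : probability (SC R) R) (D : R)
    (hsofic : forall n, sofic (mu_ n))
    (hdeg : forall n, degree (mu_ n) <= D%:E)
    (hweak : weakly_cvg (fun n => mu_ n) mu) :
  forall p : nat, betti p (mu_ n) @[n --> \oo] --> betti p mu.
Proof.
(* Rounding [D] up to a natural number, whatever its sign. *)
move=> p; apply: (@betti_cvg R p mu_ mu (Num.truncn D).+1) => // n.
by apply: bounded_deg_null (hdeg n); exact/ltW/truncnS_gt.
Qed.
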